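(* Let $W(\Lambda_0)$ be the principal subspace of the level $1$ standard $A_1^{(1)}$-module $L(\Lambda_0)$ and let $\chi_0(x,q)$ be its graded dimension with respect to charge (variable $x$) and weight (variable $q$). Then $\chi_0$ satisfies the Rogers–Ramanujan recursion $$\chi_0(x,q)=\chi_0(xq,q)+xq\,\chi_0(xq^2,q).$$
   Context: Let $\mathfrak{g}=\mathfrak{sl}(2,\mathbb{C})$ with Cartan subalgebra $\mathfrak{h}=\mathbb{C}h$, form $\langle x,y\rangle=\mathrm{tr}(xy)$, and positive root $\alpha$; via the form, $\mathfrak{h}^*$ is identified with $\mathfrak{h}$, so that $\alpha=h$ and $\langle\alpha,\alpha\rangle=2$. Let $Q=\mathbb{Z}\alpha$, with group algebra $\mathbb{C}[Q]$ having basis $\{e^\mu\}$ (so $e^\lambda e^\mu=e^{\lambda+\mu}$). Fock space: $M(1)=\mathbb{C}[h(-1),h(-2),\dots]$ is the polynomial algebra on which $h(-n)$ ($n>0$) acts by multiplication and $h(n)$ ($n>0$) acts as the derivation $2n\,\partial/\partial h(-n)$; thus $[h(m),h(n)]=2m\,\delta_{m+n,0}$. Put $V_Q=M(1)\otimes\mathbb{C}[Q]$. The operators $h(n)$, $n\neq0$, act on the first factor, and $h(0)$ acts on the second factor by $h(0)e^\lambda=\langle h,\lambda\rangle e^\lambda$. For $\lambda=c\,\alpha$ write $\lambda(n)=c\,h(n)$. On $V_Q$, $e^\lambda$ ($\lambda\in Q$) also denotes the operator $1\otimes(\text{multiplication by }e^\lambda)$, and $x^\lambda$ denotes the operator $1\otimes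 x^\lambda$ with $x^\lambda\cdot e^\mu=x^{\langle\lambda,\mu\rangle}e^\mu$. A vector $1\otimes e^\lambda$ is written $e^\lambda$. Vertex operators: for $\lambda\in Q$, $$Y(e^\lambda,x)=E^-(-\lambda,x)E^+(-\lambda,x)e^\lambda x^\lambda,$$ $$E^-(\lambda,x)=\exp\Big(\sum_{n\le-1}\frac{\lambda(n)}{n}x^{-n}\Big),\qquad E^+(\lambda,x)=\exp\Big(\sum_{n\ge1}\frac{\lambda(n)}{n}x^{-n}\Big).$$ For $m\in\mathbb{Z}$ let $x_\alpha(m)$ be the coefficient of $x^{-m-1}$ in $Y(e^\alpha,x)$, an operator on $V_Q$. (With $x_{\pm\alpha}(m)$ the coefficient of $x^{-m-1}$ in $Y(e^{\pm\alpha},x)$, $V_Q$ becomes a level $1$ module for the affine Lie algebra $\widehat{\mathfrak{sl}(2)}$, namely the irreducible highest weight module $L(\Lambda_0)$ with highest weight vector $v_{\Lambda_0}=1=1\otimes1$.) The operators $x_\alpha(m)$, $m\in\mathbb{Z}$, commute with one another. Principal subspace: $W(\Lambda_0)=U(\mathfrak{n}_+\otimes\mathbb{C}[t,t^{-1}])v_{\Lambda_0}$, where $\mathfrak{n}_+=\mathbb{C}x_\alpha$; i.e. $W(\Lambda_0)$ is the linear span of all vectors $x_\alpha(m_1)\cdots x_\alpha(m_k)v_{\Lambda_0}$ with $k\ge0$, $m_1,\dots,m_k\in\mathbb{Z}$. Gradings: $V_Q$ is graded by weight (the eigenvalue of the Virasoro operator $L(0)$), where $h(-n_1)\cdots h(-n_k)\otimes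 e^\lambda$ ($n_i>0$) has weight $n_1+\cdots+n_k+\frac12\langle\lambda,\lambda\rangle$, and by charge, the eigenvalue of $\frac12 h(0)$ (so $M(1)\otimes e^{c\alpha}$ has charge $c$). The principal subspace is a doubly graded subspace; $W(\Lambda_0)_{r,s}$ denotes its subspace of charge $r$ and weight $s$. The graded dimension is the formal series $$\chi_0(x,q)=\mathrm{tr}|_{W(\Lambda_0)}x^{\alpha/2}q^{L(0)}=\sum_{r,s}\dim W(\Lambda_0)_{r,s}\,x^rq^s.$$ *)

(* Defs.v *)
From HB Require Import structures.
From mathcomp Require Import all_boot all_order all_algebra.
From mathcomp Require Import finmap complex.
From mathcomp Require Import boolp classical_sets functions cardinality fsbigop reals.
From mathcomp Require Import monalg.

Set Implicit Arguments.
Unset Strict Implicit.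
Unset Printing Implicit Defensive.

Import Order.TTheory GRing.Theory Num.Theory.
Local Open Scope classical_set_scope.
Local Open Scope ring_scope.

Section LinearAlgebra.
Variables (K : fieldType) (V : lmodType K).

Definition lspan (A : set V) : set V :=
  [set v | exists (n : nat) (c : 'I_n -> K) (a : 'I_n -> V),
     (forall i, A (a i)) /\ v = \sum_(i < n) c i *: a i].

Definition lfree (n : nat) (b : 'I_n -> V) : Prop :=
  forall c : 'I_n -> K, \sum_(i < n) c i *: b i = 0 -> forall i, c i = 0.

Definition has_dim (S : set V) (n : nat) : Prop :=
  exists b : 'I_n -> V, lfree b /\ S = lspan (range b).

(* Equal to 0 if S has no finite basis; W_has_dim below shows that this does
   not occur for the subspaces W_ r s. *)
Definition ldim (S : set V) : nat := xget 0%N (has_dim S).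

Lemma sub_lspan_finite (N n : nat) (g : 'I_N -> V) (b : 'I_n -> V) :
  lfree b -> (forall i, lspan (range g) (b i)) -> (n <= N)%N.
Proof.
move=> fb gb.
have lg v : lspan (range g) v -> exists a : 'I_N -> K, v = \sum_j a j *: g j.
  case=> k [c [a [ag ->]]].
  have {}ag i : {j | g j = a i} by apply: cid; have [j _ <-] := ag i; exists j.
  exists (fun j => \sum_(i | sval (ag i) == j) c i).
  under [RHS]eq_bigr do rewrite scaler_suml.
  rewrite (partition_big (fun i => sval (ag i)) xpredT) //=.
  apply: eq_bigr => j _; apply: eq_bigr => i /eqP <-.
  by case: (ag i) => j' /= ->.
have {gb}gb i : {a : 'I_N -> K | b i = \sum_j a j *: g j} by apply/cid/lg.
pose A : 'M[K]_(n, N) := \matrix_(i, j) sval (gb i) j.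
rewrite leqNgt; apply/negP => ltNn.
have : kermx A != 0.
  rewrite kermx_eq0 /row_free; apply: contraL ltNn => /eqP <-.
  by rewrite -leqNgt rank_leq_col.
case/rowV0Pn => u /sub_kermxP uA /negP[]; apply/eqP/rowP => i.
rewrite mxE; apply: (fb (fun i => u 0 i)).
under eq_bigr => k _.
  rewrite (svalP (gb k)) scaler_sumr.
  under eq_bigr do rewrite scalerA.
  over.
rewrite exchange_big /= big1 // => j _; rewrite -scaler_suml.
move/rowP/(_ j): uA; rewrite !mxE => uA.
rewrite [X in X *: _](_ : _ = 0) ?scale0r // -[RHS]uA.
by apply: eq_bigr => k _; rewrite !mxE.
Qed.

Lemma lspan_sub (A : set V) v : A v -> lspan A v.
Proof.
by move=> Av; exists 1%N, (fun=> 1), (fun=> v); rewrite big_ord1 scale1r.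
Qed.

Lemma lspanZ (A : set V) k v : lspan A v -> lspan A (k *: v).
Proof.
case=> n [c [a [Aa ->]]]; exists n, (fun i => k * c i), a; split=> //.
by rewrite scaler_sumr; apply: eq_bigr => i _; rewrite scalerA.
Qed.

Lemma lspan_sum (A : set V) (I : Type) (r : seq I) (P : pred I) (F : I -> V) :
  (forall i, P i -> lspan A (F i)) -> lspan A (\sum_(i <- r | P i) F i).
Proof.
move=> AF; apply: (big_ind (lspan A)) => //.
  by exists 0%N, (fun=> 0), (fun=> 0); rewrite big_ord0; split=> // -[].
move=> _ _ [m [c [a [Aa ->]]]] [n [c' [a' [Aa' ->]]]].
exists (m + n)%N.
exists (fun i => match fintype.split i with inl j => c j | inr j => c' j end).
exists (fun i => match fintype.split i with inl j => a j | inr j => a' j end).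
split=> [i|]; first by case: (fintype.split i).
rewrite big_split_ord /=; congr (_ + _); apply: eq_bigr => i _.
  by rewrite -[lshift n i]/(unsplit (inl i)) unsplitK.
by rewrite -[rshift m i]/(unsplit (inr i)) unsplitK.
Qed.

Lemma has_dim_uniq (S : set V) m n : has_dim S m -> has_dim S n -> m = n.
Proof.
move=> [b [fb Sb]] [b' [fb' Sb']]; apply/eqP; rewrite eqn_leq.
apply/andP; split.
- apply: (@sub_lspan_finite _ _ b' b) => // i.
  by rewrite -Sb' Sb; apply: lspan_sub; exists i.
- apply: (@sub_lspan_finite _ _ b b') => // i.
  by rewrite -Sb Sb'; apply: lspan_sub; exists i.
Qed.

Lemma ldimE (S : set V) n : has_dim S n -> ldim S = n.
Proof. by move=> Sn; apply: xget_unique => // m /has_dim_uniq; apply. Qed.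

Lemma lspan_finite_has_dim (S : set V) N (g : 'I_N -> V) :
  S = lspan S -> S `<=` lspan (range g) -> exists n, has_dim S n.
Proof.
move=> SS Sg.
pose P n := `[< exists b : 'I_n -> V, lfree b /\ forall i, S (b i) >].
have P0 : exists n, P n.
  by exists 0%N; apply/asboolP; exists (fun=> 0); split=> [c _ []|[]].
have PN n : P n -> (n <= N)%N.
  move=> /asboolP[b [fb Sb]]; apply: (sub_lspan_finite fb) => i.
  exact/Sg.
have [n /asboolP[b [fb Sb]] nmax] := ex_maxnP P0 PN.
exists n, b; split=> //; apply/seteqP; split=> v; last first.
  move=> [k [c [a [ab ->]]]]; rewrite SS; exists k, c, a; split=> // i.
  by have [j _ <-] := ab i.
move=> Sv; pose b' (i : 'I_n.+1) := if unlift ord0 i is Some j then b j else v.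
have b'0 : b' ord0 = v by rewrite /b' unlift_none.
have b'S j : b' (lift ord0 j) = b j by rewrite /b' liftK.
have [//|nfb'] := pselect (lfree b').
  move=> fb'; suff /nmax : P n.+1 by rewrite ltnn.
  apply/asboolP; exists b'; split=> // i.
  by rewrite /b'; case: (unlift _ _).
have [c c0 [i ci]] : exists2 c : 'I_n.+1 -> K,
    \sum_i c i *: b' i = 0 & exists i, c i <> 0.
  apply: contrapT => H; apply: nfb' => c c0 i; apply: contrapT => ci.
  by apply: H; exists c => //; exists i.
move: c0; rewrite big_ord_recl b'0; under eq_bigr do rewrite b'S.
move=> c0; have [c00|c00] := eqVneq (c ord0) 0.
  move: c0; rewrite c00 scale0r add0r => /fb {}fb; case: ci.
  by case: (unliftP ord0 i) => [j|] ->.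
exists n, (fun j => - (c ord0)^-1 * c (lift ord0 j)), b.
split=> [j|]; first by exists j.
under eq_bigr do rewrite -scalerA.
rewrite -scaler_sumr; move/eqP: c0; rewrite addrC addr_eq0 => /eqP ->.
by rewrite scaleNr scalerN opprK scalerA mulVf // scale1r.
Qed.

End LinearAlgebra.

(* An operator-valued formal series \sum_k A_k x^k (k : int) is the family of
   its coefficients.  All the sums over infinite index sets below are
   \sum_(i \in _) of fsbigop, i.e. they are finite sums on each vector as soon
   as the summand has finite support, which is the case for all the series
   used here. *)
Section OperatorSeries.
Variables (K : fieldType) (V : lmodType K).

Definition opseries := int -> V -> V.

Definition ops_const (f : V -> V) : opseries :=
  fun k v => if k == 0 then f v else 0.

Definition ops_mul (A B : opseries) : opseries :=
  fun k v => \sum_(i \in [set: int]) A i (B (k - i) v).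

Definition ops_pow (A : opseries) (j : nat) : opseries :=
  iter j (ops_mul A) (ops_const id).

Definition ops_exp (A : opseries) : opseries :=
  fun k v => \sum_(j \in [set: nat]) (j`!%:R)^-1 *: ops_pow A j k v.

End OperatorSeries.

(* The root lattice Q = Z alpha is represented by int, c standing for c alpha;
   since <alpha, alpha> = 2, the form is as follows. *)
Definition Qform (a b : int) : int := 2 * a * b.

Section LatticeVertexOperators.
Variable R : realType.
Local Notation C := R[i].

(* The pair (m, c) stands for the basis vector
   (\prod_i h(-(i+1))^(m i)) \otimes e^(c alpha) of M(1) \otimes C[Q]. *)
Definition VQbasis : choiceType := ({cmonom nat} * int)%type.
Local Notation VQ := {malg C[VQbasis]}.

Definition bvec (b : VQbasis) : VQ := << b >>.

(* The linear extension of f : VQbasis -> VQ. *)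
Definition lext (f : VQbasis -> VQ) (v : VQ) : VQ :=
  \sum_(b <- msupp v) v@_b *: f b.

(* The operator h(n); Negz n' is - (n' + 1), and h(n' + 1) is
   2 (n' + 1) d/dh(-(n' + 1)), where divcm lowers an exponent by 1 (truncated
   at 0, where the coefficient vanishes anyway). *)
Definition heis (n : int) : VQ -> VQ :=
  match n with
  | Posz 0 => lext (fun b => (Qform 1 b.2)%:~R *: bvec b)
  | Posz n'.+1 =>
      lext (fun b => (2 * n'.+1 * b.1 n')%:R *: bvec (divcm b.1 (ucm n'), b.2))
  | Negz n' => lext (fun b => bvec (mmul (ucm n') b.1, b.2))
  end.

(* lambda(n) for lambda = c alpha *)
Definition lat (c n : int) (v : VQ) : VQ := c%:~R *: heis n v.

(* The coefficient of x^k in \sum_n (lambda(n) / n) x^(-n) comes from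
   n = - k. *)
Definition Eminus (c : int) : opseries VQ :=
  ops_exp (fun k v => if - k <= -1 then (- k)%:~R^-1 *: lat c (- k) v else 0).

Definition Eplus (c : int) : opseries VQ :=
  ops_exp (fun k v => if 1 <= - k then (- k)%:~R^-1 *: lat c (- k) v else 0).

Definition e_op (c : int) : VQ -> VQ := lext (fun b => bvec (b.1, c + b.2)).

Definition x_op (c : int) : opseries VQ :=
  fun k => lext (fun b => if k == Qform c b.2 then bvec b else 0).

Definition Y (c : int) : opseries VQ :=
  ops_mul (Eminus (- c))
    (ops_mul (Eplus (- c)) (ops_mul (ops_const (e_op c)) (x_op c))).

Definition x_alpha (m : int) : VQ -> VQ := Y 1 (- m - 1).

Definition vac : VQ := bvec (mone, 0).

Definition W : set VQ :=
  lspan (range (fun ms : seq int => foldr x_alpha vac ms)).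

(* 1/2 <c alpha, c alpha> = c ^ 2 *)
Definition bweight (b : VQbasis) : int :=
  (\sum_(i <- finsupp b.1) i.+1 * b.1 i)%N%:Z + b.2 ^+ 2.

Definition L0 : VQ -> VQ := lext (fun b => (bweight b)%:~R *: bvec b).

Definition W_ (r s : int) : set VQ :=
  [set v | [/\ W v, 2^-1 *: heis 0 v = r%:~R *: v & L0 v = s%:~R *: v]].

Lemma lext_diag (a : VQbasis -> C) (v : VQ) b :
  (lext (fun b => a b *: bvec b) v)@_b = v@_b * a b.
Proof.
rewrite /lext raddf_sum /=.
under eq_bigr => k _ do rewrite !mcoeffZ mcoeffU.
have [vb|vb] := boolP (b \in msupp v); last first.
  rewrite (mcoeff_outdom vb) mul0r big_seq big1 // => k kv.
  by case: eqVneq kv vb => [-> ->|_ _ _]; rewrite //= ?mulr0n ?mulr0.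
rewrite (big_fsetD1 b) //= eqxx mulr1 big1_fset ?addr0 // => k.
by rewrite in_fsetD1 => /andP[/negbTE -> _] _; rewrite mulr0n !mulr0.
Qed.

Lemma W_has_dim r s : exists n, has_dim (W_ r s) n.
Proof.
pose N := `|s - r ^+ 2|%N.+1.
pose T := {ffun 'I_N -> 'I_N}.
pose mon (f : T) : {cmonom nat} :=
  mkcmonom [fsfun i in [fset i | i in iota 0 N]%fset =>
              (f (inord i) : nat) | 0%N].
pose g (i : 'I_#|T|) : VQ := bvec (mon (enum_val i), r).
have h0 w : 2^-1 *: heis 0 w =
    lext (fun b => (2^-1 * (Qform 1 b.2)%:~R) *: bvec b) w.
  apply/malgP => b; rewrite (mcoeffZ _ (heis 0 w)).
  rewrite [in RHS](lext_diag (fun b => 2^-1 * (Qform 1 b.2)%:~R)).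
  by rewrite (lext_diag (fun b => (Qform 1 b.2)%:~R)) mulrCA.
apply: (@lspan_finite_has_dim _ _ _ _ g).
  apply/seteqP; split=> v; first exact: lspan_sub.
  move=> [n [c [a [ha ->]]]].
  have lin (f : VQbasis -> C) (t : C) :
      (forall i, lext (fun b => f b *: bvec b) (a i) = t *: a i) ->
    lext (fun b => f b *: bvec b) (\sum_i c i *: a i) = t *: \sum_i c i *: a i.
    move=> fa; apply/malgP => b; rewrite lext_diag mcoeffZ !raddf_sum /=.
    rewrite mulr_suml mulr_sumr; apply: eq_bigr => i _.
    rewrite (mcoeffZ (c i) (a i) b) -mulrA -(lext_diag f) (fa i).
    by rewrite (mcoeffZ t (a i) b) mulrCA.
  split.
  - rewrite /W; apply: lspan_sum => i _; apply: lspanZ.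
    by case: (ha i).
  - apply: (etrans (h0 _)); apply: lin => i.
    by case: (ha i) => _ hai _; exact: etrans (esym (h0 _)) hai.
  - by apply: lin => i; case: (ha i).
move=> v [_ hv Lv].
rewrite (monalgE v) big_seq; apply: lspan_sum => b.
rewrite -mcoeff_neq0 => vb.
have b2 : b.2 = r.
  move/(etrans (esym (h0 v)))/(congr1 (mcoeff b)): hv.
  rewrite (mcoeffZ _ v) lext_diag mulrC => /(mulIf vb).
  rewrite /Qform mulr1 intrM mulKf ?pnatr_eq0 //.
  by move/intr_inj.
have bs : bweight b = s.
  by move/(congr1 (mcoeff b)): Lv; rewrite lext_diag (mcoeffZ _ v) mulrC => /(mulIf vb)/intr_inj.
rewrite -[v@_b]mulr1 -[<<_ *g _>>]/(mkmalgU _ _).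
have -> : << v@_b * 1 *g b >> = v@_b *: bvec b.
  by apply/malgP => k; rewrite mcoeffZ !mcoeffU mulr1 mulr_natr.
apply/lspanZ/lspan_sub.
have bN i : (i.+1 * b.1 i < N)%N.
  have [ib|] := boolP (i \in finsupp b.1); last first.
    by rewrite -cmE_eq0 => /eqP ->; rewrite muln0.
  rewrite ltnS -lez_nat -bs -b2 /bweight addrK (big_fsetD1 i) //=.
  by rewrite lez_nat leq_addr.
have bi i : (b.1 i < N)%N by apply: leq_ltn_trans (bN i); rewrite leq_pmull.
pose f : T := [ffun i : 'I_N => inord (b.1 i)].
exists (enum_rank f) => //; rewrite /g enum_rankK.
suff -> : mon f = b.1 by rewrite -b2 -surjective_pairing.
apply/eqP/cmP => i; rewrite cmE /= fsfun_fun.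
rewrite [i \in _](_ : _ = (i < N)%N); last by rewrite !inE mem_iota; case: (i).
case: ifPn => iN; first by rewrite ffunE !inordK.
apply/esym/eqP; apply: contraNT iN => bi0.
by apply: leq_ltn_trans (bN i); rewrite (leq_trans (leqnSn i)) // leq_pmulr // lt0n.
Qed.

End LatticeVertexOperators.

(* Formal series in x and q with exponents in int; f r s is the coefficient of
   x^r q^s. *)
Definition xqseries := int -> int -> nat.

Definition series_add (f g : xqseries) : xqseries :=
  fun r s => (f r s + g r s)%N.

(* x^a q^b f(x, q) *)
Definition mul_monomial (a b : int) (f : xqseries) : xqseries :=
  fun r s => f (r - a) (s - b).

(* f(x q^k, q): the term x^r q^s is sent to x^r q^(s + k r). *)
Definition subst_xq (k : int) (f : xqseries) : xqseries :=
  fun r s => f r (s - k * r).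

Definition chi0 (R : realType) : xqseries := fun r s => ldim (@W_ R r s).

(* Main.v *)
(* W(Lambda_0) has charge r part M_r (x) e^(r alpha), where M_r is spanned by the
   products h_(k_1) .. h_(k_r) of complete homogeneous symmetric functions,
   h(-n) playing the role of the n-th power sum.  Indeed E^-(-alpha, x) multiplies
   by \sum_k h_k x^k, while E^+(-alpha, x) is the algebra morphism
   h_k |-> h_k - 2 x^(-1) h_(k-1) + x^(-2) h_(k-2), so x_alpha(m) maps
   M_r (x) e^(r alpha) to M_(r+1) (x) e^((r+1) alpha), and its leading term
   h_k h_(k_1) .. h_(k_r), k = - m - 1 - 2r, can be isolated by downward induction
   on k.  The h_k with k > 0 being algebraically independent, dim W_(r,s) is the
   number of multisets of r natural numbers with sum s - r^2; separating those
   containing 0 from those with only positive members gives the recursion. *)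
Require Import Defs.
From HB Require Import structures.
From mathcomp Require Import all_boot all_order all_algebra finmap complex.
From mathcomp Require Import boolp classical_sets functions cardinality fsbigop reals.
From mathcomp Require Import monalg zify ring.

Set Implicit Arguments.
Unset Strict Implicit.
Unset Printing Implicit Defensive.

Import Order.TTheory GRing.Theory Num.Theory.
Local Open Scope classical_set_scope.
Local Open Scope ring_scope.

(** No exponential of operators is ever expanded. The Euler derivation x d/dx turns E = exp A into
    the recursion k E_k = sum_n n A_n E_(k-n), which in characteristic 0 has exactly one solution
    for each initial vector. A candidate that satisfies the recursion is therefore the exponential;
    this identifies the action of E^- and E^+ and gives the linearity of E^+. For h_k the recursion
    is Newton's identity. The three-term shape of the twist comes from h(n) = 2 n d/dp_n:
    E^+(-alpha, x) translates p_n by - 2 y^n with y = x^(-1), and exp(- 2 sum_n (y z)^n / n) = (1 -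
    y z)^2. The products of series are sums with finite support over the integers, so neither the
    value nor the linearity of x_alpha(m) is automatic. Both are established on M_r (x) e^(r alpha)
    only, where the twist of a product of r factors has degree at most 2 r in y and all sums fit in
    one finite window. The h_k are indexed by all integers, with h_0 = 1 and h_k = 0 for k < 0,
    which keeps the recursions free of boundary cases. *)

(** * Exponentials of operator series and their Euler equation *)

Section OperatorExponential.
Variables (K : numFieldType) (V : lmodType K) (a : opseries V).
Hypothesis a_lin : forall k, linear (a k).
Hypothesis a_supp : forall k v, k <= 0 -> a k v = 0.
Hypothesis a_comm : forall i j v, a i (a j v) = a j (a i v).

HB.instance Definition _ k := GRing.isLinear.Build K V V *:%R (a k) (a_lin k).

Let aZ k c v : a k (c *: v) = c *: a k v.
Proof. exact: linearZZ. Qed.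

Let a_sum k n (F : 'I_n -> V) : a k (\sum_(i < n) F i) = \sum_(i < n) a k (F i).
Proof. exact: linear_sum. Qed.

(** Since [a] lives in positive degrees and [B] in nonnegative ones, only 0 < i <= k contributes.
    The bound [N] may exceed [k], so that one window serves several degrees at once. *)
Lemma ops_mul_supp (B : opseries V) (N : nat) k v :
  (forall l u, l < 0 -> B l u = 0) -> k <= N%:Z ->
  ops_mul a B k v = \sum_(i < N) a i.+1 (B (k - i.+1%:Z) v).
Proof.
move=> B0 kN; rewrite /ops_mul.
rewrite -(big_mkord xpredT (fun i => a i.+1 (B (k - i.+1%:Z) v))).
rewrite -(big_map (fun i => i.+1%:Z) xpredT (fun i => a i (B (k - i) v))).
rewrite (fsbigE [seq i.+1%:Z | i <- index_iota 0 N]) //; last first.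
- move=> i _ iN; have [i0|i0] := leP i 0; first exact: a_supp.
  rewrite B0 ?linear0 //; apply: contraNT iN => ki.
  by apply/mapP; exists `|i|.-1%N; rewrite ?mem_index_iota; lia.
- by rewrite map_inj_uniq ?iota_uniq // => i j [].
- by rewrite big_seq_cond [RHS]big_seq_cond; apply: eq_bigl => i; rewrite andbT andbC in_setT.
Qed.

Local Arguments ops_pow : simpl never.

Lemma ops_pow_lt j k v : k < j%:Z -> ops_pow a j k v = 0.
Proof.
elim: j k v => [|j IH] k v kj; first by rewrite /ops_pow /= /ops_const lt_eqF.
rewrite /ops_pow /= /ops_mul fsbig1 // => i _; have [i0|i0] := leP i 0.
  exact: a_supp.
by rewrite -/(ops_pow a j) IH ?linear0 //; lia.
Qed.

Lemma ops_powS j (N : nat) k v : k <= N%:Z ->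
  ops_pow a j.+1 k v = \sum_(i < N) a i.+1 (ops_pow a j (k - i.+1%:Z) v).
Proof. by apply: ops_mul_supp => l u l0; apply: ops_pow_lt; lia. Qed.

Lemma ops_pow_deriv j (N : nat) k v : k <= N%:Z ->
  k%:~R *: ops_pow a j.+1 k v =
  j.+1%:R *: \sum_(i < N) i.+1%:R *: a i.+1 (ops_pow a j (k - i.+1%:Z) v).
Proof.
elim: j k => [|j IH] k kN; rewrite (ops_powS _ _ kN).
  rewrite scale1r scaler_sumr; apply: eq_bigr => i _; rewrite /ops_pow /= /ops_const.
  have [/eqP|_] := eqVneq; last by rewrite linear0 !scaler0.
  by rewrite subr_eq0 => /eqP ->.
rewrite [in RHS]mulrSr scalerDl scale1r scaler_sumr.
under eq_bigr => i _.
  (* Product rule: the degree k splits as (k - (i+1)) + (i+1); the first part falls to the induction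
     hypothesis, the second is the new summand. *)
  rewrite -[X in X%:~R](subrK i.+1%:Z) intrD scalerDl -aZ IH; last by lia.
  rewrite aZ a_sum.
  under eq_bigr do rewrite aZ a_comm.
  over.
rewrite big_split /=; congr (_ + _); rewrite -scaler_sumr; congr (_ *: _).
rewrite exchange_big; apply: eq_bigr => i _ /=.
rewrite -scaler_sumr; congr (_ *: _).
have /(ops_powS j) -> : k - i.+1%:Z <= N%:Z by lia.
by rewrite a_sum; apply: eq_bigr => l _; rewrite -!addrA [- _ - _]addrC.
Qed.

Lemma ops_exp_supp (N : nat) k v : k <= N%:Z ->
  ops_exp a k v = \sum_(j < N.+1) (j`!%:R)^-1 *: ops_pow a j k v.
Proof.
move=> kN; rewrite /ops_exp.
rewrite -(big_mkord xpredT (fun j => (j`!%:R)^-1 *: ops_pow a j k v)).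
rewrite (fsbigE (index_iota 0 N.+1)) ?iota_uniq //.
  by rewrite big_seq_cond [RHS]big_seq_cond; apply: eq_bigl => i; rewrite andbT andbC in_setT.
move=> i _; rewrite mem_index_iota => iN.
by rewrite ops_pow_lt ?scaler0 //; lia.
Qed.

Lemma ops_exp_lt0 k v : k < 0 -> ops_exp a k v = 0.
Proof.
move=> k0; rewrite /ops_exp fsbig1 // => j _.
by rewrite ops_pow_lt ?scaler0 //; lia.
Qed.

Lemma ops_exp0 v : ops_exp a 0 v = v.
Proof.
by rewrite (@ops_exp_supp 0) // big_ord1 fact0 invr1 scale1r.
Qed.

(* The Euler operator applied to the exponential: x d/dx exp A = (x d/dx A) exp A. *)
Lemma ops_exp_deriv (N : nat) k v : k <= N%:Z ->
  k%:~R *: ops_exp a k v =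
  \sum_(i < N) i.+1%:R *: a i.+1 (ops_exp a (k - i.+1%:Z) v).
Proof.
move=> kN; rewrite (ops_exp_supp _ kN) scaler_sumr big_ord_recl /=.
rewrite [X in X + _](_ : _ = 0) ?add0r; last first.
  rewrite /ops_pow /= /ops_const; have [->|_] := eqVneq; last by rewrite !scaler0.
  by rewrite scale0r.
under eq_bigr => j _.
  rewrite scalerA mulrC -scalerA (ops_pow_deriv _ _ kN) scalerA.
  rewrite /bump /= add1n factS natrM invfM mulrAC mulVf ?pnatr_eq0 // mul1r.
  rewrite scaler_sumr; over.
rewrite exchange_big; apply: eq_bigr => i _ /=.
(* The window shrinks by one so that this exponential has exactly the [N] powers that remain after j
   = 0 has been removed. *)
have kiN : k - i.+1%:Z <= N.-1%:Z by case: N kN i => [|N] kN i; [case: i|lia].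
rewrite (ops_exp_supp _ kiN) prednK; last by case: N {kN kiN} i => // -[].
rewrite a_sum scaler_sumr; apply: eq_bigr => j _.
by rewrite aZ scalerA mulrC -scalerA.
Qed.

(** Division by n recovers u n from the lower coefficients. Every exponential below is identified by
    exhibiting a candidate [u] and checking this recursion. *)
Lemma ops_exp_unique (u : int -> V) :
  (forall k, k < 0 -> u k = 0) ->
  (forall N : nat,
     N%:R *: u N = \sum_(i < N) i.+1%:R *: a i.+1 (u (N%:Z - i.+1%:Z))) ->
  forall k, ops_exp a k (u 0) = u k.
Proof.
move=> u0 uS k; have [k0|] := ltP k 0; first by rewrite (u0 k) // ops_exp_lt0.
case: k => // n _; have [m] := ubnP n; elim: m n => // m IH [|n] nm.
  exact: ops_exp0.
apply: (@scalerI _ _ n.+1%:R); first by rewrite pnatr_eq0.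
rewrite uS -[n.+1%:R]/(n.+1%:Z%:~R) (@ops_exp_deriv n.+1) //.
apply: eq_bigr => i _; congr (_ *: a _ _).
rewrite subzn // IH //; lia.
Qed.

End OperatorExponential.

(** Brings E^+, a series in x^(-1), under the results for series supported in positive degrees. *)
Lemma ops_exp_opp (K : fieldType) (V : lmodType K) (a : opseries V) k v :
  ops_exp a (- k) v = ops_exp (fun l => a (- l)) k v.
Proof.
rewrite /ops_exp; apply: eq_fsbigr => j _; congr (_ *: _).
elim: j k v => [|j IH] k v; first by rewrite /= /ops_const oppr_eq0.
rewrite /= /ops_mul (@reindex_fsbigT _ _ _ _ _ (fun i : int => - i)) /=; last first.
  by exists -%R; apply: opprK.
by apply: eq_fsbigr => i _; rewrite -opprD IH.
Qed.

(** * Linear extension from a basis *)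

Section LinearExtension.
Variables (F : fieldType) (T : choiceType) (V : lmodType F).
Implicit Types v : {malg F[T]}.

(** The formula of [lext] with an arbitrary target, so that it also yields derivations, evaluations
    and the embeddings of M(1) into V_Q. *)
Definition mext (f : T -> V) v : V := \sum_(b <- msupp v) v@_b *: f b.

Lemma mextEw (d : {fset T}) f v : (msupp v `<=` d)%fset ->
  mext f v = \sum_(b <- d) v@_b *: f b.
Proof.
move=> le; rewrite [LHS](big_fset_incl _ le) => //= x xd /mcoeff_outdom ->.
by rewrite scale0r.
Qed.

Lemma mext_is_linear f : linear (mext f).
Proof.
move=> c u v; pose d := (msupp u `|` msupp v)%fset.
have ud : (msupp u `<=` d)%fset by apply: fsubsetUl.
have vd : (msupp v `<=` d)%fset by apply: fsubsetUr.
have cud : (msupp (c *: u) `<=` d)%fset by apply: fsubset_trans (msuppZ_le _ _) ud.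
have cuvd : (msupp (c *: u + v) `<=` d)%fset.
  by apply: fsubset_trans (msuppD_le _ _) _; rewrite fsubUset cud.
rewrite (mextEw _ cuvd) (mextEw _ ud) (mextEw _ vd) scaler_sumr -big_split /=.
by apply: eq_bigr => b _; rewrite mcoeffD (mcoeffZ c u) scalerDl scalerA.
Qed.
HB.instance Definition _ f :=
  GRing.isLinear.Build F {malg F[T]} V *:%R (mext f) (mext_is_linear f).

Lemma mextU f b : mext f << b >> = f b.
Proof. by rewrite (mextEw _ msuppU_le) big_seq_fset1 mcoeffUU scale1r. Qed.

Lemma malgU_scale c (b : T) : << c *g b >> = c *: << b >> :> {malg F[T]}.
Proof. by apply/malgP => k; rewrite (mcoeffZ c << b >>) !mcoeffU mulr_natr. Qed.

Lemma malg_linear_ext (f g : {malg F[T]} -> V) : linear f -> linear g ->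
  (forall b, f << b >> = g << b >>) -> f =1 g.
Proof.
move=> lf lg fg v.
pose f' := GRing.isLinear.Build _ _ _ _ f lf.
pose g' := GRing.isLinear.Build _ _ _ _ g lg.
pose F' : {linear _ -> _} := HB.pack f f'; pose G' : {linear _ -> _} := HB.pack g g'.
rewrite -[f]/(F' : _ -> _) -[g]/(G' : _ -> _) (monalgE v) !linear_sum.
by apply: eq_bigr => b _; rewrite malgU_scale !linearZZ /= fg.
Qed.

End LinearExtension.

(** * Complete homogeneous symmetric functions and their twist *)

(** Here c = l, while x, y, z are the values of a function at l, l - 1, l - 2 and s is the sum of
    its values below l - 2. The tail s cancels because - 2 + 4 - 2 = 0. *)
Lemma second_difference (F : fieldType) (A : comAlgType F) (c : F) (x y z s : A) :
  c *: (x - 2 *: y + z) =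
  c *: x - 2 *: (y + (z + s)) - 2 *: ((c - 1) *: y - 2 *: (z + s)) +
  ((c - 2) *: z - 2 *: s).
Proof.
rewrite !scalerBl scale1r !(scaler_nat 2).
rewrite -[c *: (x - _ + z)]mulr_algl -[c *: x]mulr_algl -[c *: y]mulr_algl -[c *: z]mulr_algl.
ring. Qed.

Section CompleteSymmetric.
Variables (F : numFieldType) (A : comAlgType F) (p : nat -> A).

Definition pmul : opseries A :=
  fun k P => if 1 <= k then k%:~R^-1 *: (p `|k|.-1 * P) else 0.

Lemma pmul_linear k : linear (pmul k).
Proof.
move=> c u v; rewrite /pmul; case: ifP => _; last by rewrite scaler0 addr0.
by rewrite mulrDr -scalerAr scalerDr !scalerA mulrC.
Qed.

Lemma pmul_supp k P : k <= 0 -> pmul k P = 0.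
Proof. by rewrite /pmul; case: ifP => //; lia. Qed.

Lemma pmul_comm i j P : pmul i (pmul j P) = pmul j (pmul i P).
Proof.
rewrite /pmul; do 2![case: ifP => _]; rewrite ?mulr0 ?scaler0 //.
by rewrite -!scalerAr !scalerA mulrCA [_^-1 * _]mulrC.
Qed.

(* When p i is the power sum of degree i + 1, the coefficients of
   exp(\sum_n (p_n / n) x^n) are the complete homogeneous symmetric functions. *)
Definition hsym (k : int) : A := ops_exp pmul k 1.

Lemma hsym_lt0 k : k < 0 -> hsym k = 0.
Proof. exact: (ops_exp_lt0 pmul_linear pmul_supp). Qed.

Lemma hsym0 : hsym 0 = 1.
Proof. exact: (ops_exp0 pmul_linear pmul_supp). Qed.

Lemma hsym_newton (N : nat) k : k <= N%:Z ->
  k%:~R *: hsym k = \sum_(i < N) p i * hsym (k - i.+1%:Z).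
Proof.
move=> kN; rewrite [LHS](ops_exp_deriv pmul_linear pmul_supp pmul_comm _ kN).
by apply: eq_bigr => i _; rewrite /pmul /= scalerA mulfV ?scale1r ?pnatr_eq0.
Qed.

Lemma hsym_unique (u : int -> A) : (forall k, k < 0 -> u k = 0) -> u 0 = 1 ->
  (forall n : nat, n%:R *: u n = \sum_(i < n) p i * u (n%:Z - i.+1%:Z)) ->
  forall k, hsym k = u k.
Proof.
move=> u_lt0 u0 uS k; rewrite /hsym -u0.
apply: (ops_exp_unique pmul_linear pmul_supp pmul_comm u_lt0) => n.
rewrite uS; apply: eq_bigr => i _.
by rewrite /pmul /= scalerA mulfV ?scale1r ?pnatr_eq0.
Qed.

Lemma hsym_lt0M k P : k < 0 -> hsym k * P = 0.
Proof. by move=> k0; rewrite hsym_lt0 ?mul0r. Qed.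

Lemma hsym0M P : hsym 0 * P = P.
Proof. by rewrite hsym0 mul1r. Qed.

Lemma hsym_newtonM (n : nat) P :
  n%:R *: (hsym n * P) = \sum_(i < n) p i * (hsym (n%:Z - i.+1%:Z) * P).
Proof.
rewrite scalerAl -[n%:R]/(n%:Z%:~R) (@hsym_newton n) // mulr_suml.
by apply: eq_bigr => i _; rewrite mulrA.
Qed.

Definition hprod (s : seq int) : A := \prod_(k <- s) hsym k.

Section Grading.
Variable homog : int -> A -> Prop.
Hypothesis homog_lspan : forall k P, lspan (homog k) P -> homog k P.
Hypothesis homog1 : homog 0 1.
Hypothesis homogM : forall j k P Q, homog j P -> homog k Q -> homog (j + k) (P * Q).
Hypothesis homogp : forall i : nat, homog i.+1 (p i).

(** Newton's identity writes n h_n as a sum of homogeneous products of lower h's, and n is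
    invertible. *)
Lemma homog_hsym k : homog k (hsym k).
Proof.
have homog0 j : homog j 0.
  by apply: homog_lspan; exists 0%N, (fun=> 0), (fun=> 0); rewrite big_ord0; split=> // -[].
have [k0|] := ltP k 0; first by rewrite hsym_lt0.
case: k => // n _; have [b] := ubnP n; elim: b n => // b IH [|n] nb.
  by rewrite hsym0.
have n0 : n.+1%:Z%:~R != 0 :> F by rewrite pnatr_eq0.
rewrite -[hsym _]scale1r -(mulVf n0) -scalerA; apply/homog_lspan/lspanZ.
rewrite (@hsym_newton n.+1) //; apply: lspan_sum => i _; apply: lspan_sub.
rewrite [X in homog X _](_ : _ = i.+1%:Z + (n.+1%:Z - i.+1%:Z)); last by lia.
by apply: homogM => //; rewrite subzn //; apply: IH; lia.
Qed.

Lemma homog_hprod s : homog (\sum_(k <- s) k) (hprod s).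
Proof.
rewrite /hprod; elim: s => [|k s IH]; first by rewrite !big_nil.
by rewrite !big_cons; apply: homogM => //; apply: homog_hsym.
Qed.

End Grading.

(* The coefficient of y^l in \prod_(k in s) (h_k - 2 y h_(k-1) + y^2 h_(k-2)),
   the image of \prod_(k in s) h_k under p_n |-> p_n - 2 y^n. *)
Fixpoint htwist (s : seq int) (l : int) : A :=
  if s is k :: s' then
    hsym k * htwist s' l - 2 *: (hsym (k - 1) * htwist s' (l - 1))
    + hsym (k - 2) * htwist s' (l - 2)
  else (l == 0)%:R.

Lemma htwist_lt0 s l : l < 0 -> htwist s l = 0.
Proof.
elim: s l => [|k s IH] l l0 /=; first by rewrite lt_eqF.
by rewrite !IH ?mulr0 ?scaler0 ?addr0 ?subr0 //; lia.
Qed.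

Lemma htwist0 s : htwist s 0 = hprod s.
Proof.
rewrite /hprod; elim: s => [|k s IH] /=; first by rewrite big_nil.
by rewrite big_cons IH !htwist_lt0 // !mulr0 scaler0 subr0 addr0.
Qed.

Lemma htwist_gt s l : (2 * size s)%:Z < l -> htwist s l = 0.
Proof.
elim: s l => [|k s IH] l /= l0; first by rewrite gt_eqF.
by rewrite !IH ?mulr0 ?scaler0 ?addr0 ?subr0 //; lia.
Qed.

(** Each factor lowers its index by 0, 1 or 2 and pays the same power of y. Keeping the number of
    factors places the image of x_alpha(m) in M_(r+1); the drop of the index sum by l drives the
    triangularity argument. *)
Lemma htwist_lspan s l :
  lspan [set hprod s' | s' in [set s' | size s' = size s /\
                                  \sum_(k <- s') k = \sum_(k <- s) k - l]]
        (htwist s l).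
Proof.
elim: s l => [|k s IH] l /=.
  have [->|_] := eqVneq l 0; last first.
    by exists 0%N, (fun=> 0), (fun=> 0); rewrite big_ord0; split=> // -[].
  by apply: lspan_sub; exists [::]; [rewrite /= big_nil subr0|rewrite /hprod big_nil].
have step (a : int) :
    lspan [set hprod s' | s' in [set s' | size s' = (size s).+1 /\
                             \sum_(k <- s') k = \sum_(k <- (k :: s)) k - l]]
          (hsym (k - a) * htwist s (l - a)).
  have [n [c [f [fP ->]]]] := IH (l - a).
  rewrite mulr_sumr; apply: lspan_sum => i _; rewrite -scalerAr.
  apply/lspanZ/lspan_sub; have [s' [ss' sums'] <-] := fP i.
  exists (k - a :: s'); last by rewrite /hprod big_cons.
  split; first by rewrite /= ss'.
  by rewrite !big_cons sums'; move: (\sum_(j <- s) j) => x; lia.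
rewrite -scaleNr.
have -> : hsym k * htwist s l = hsym (k - 0) * htwist s (l - 0) by rewrite !subr0.
have {}step : forall c : F, forall a : int, lspan _ (c *: (hsym (k - a) * htwist s (l - a))) :=
  fun c a => lspanZ c (step a).
(* The weights 1, - 2, 1 are the coefficients of (1 - y)^2, and the index is the drop [a]. *)
have := @lspan_sum _ _ _ _ (index_enum 'I_3) xpredT
  (fun i : 'I_3 => [:: 1; - 2; 1]`_i *: (hsym (k - i%:Z) * htwist s (l - i%:Z)))
  (fun i _ => step _ i%:Z).
by rewrite !big_ord_recl big_ord0 [X in _ + (_ + X)]addr0 /= /bump /= !scale1r addrA.
Qed.

Lemma sum_shift (N : nat) (l : int) (g : int -> A) :
    (forall j, j < 0 -> g j = 0) -> l <= N%:Z ->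
  \sum_(i < N) g (l - i.+1%:Z) = g (l - 1) + \sum_(i < N) g (l - 1 - i.+1%:Z).
Proof.
case: N => [|N] g0 lN; first by rewrite !big_ord0 g0 ?addr0 //; lia.
rewrite big_ord_recl; congr (_ + _); rewrite big_ord_recr /= [X in _ + X]g0; last by lia.
by rewrite addr0; apply: eq_bigr => i _; rewrite /bump /=; congr g; lia.
Qed.

Variable d : nat -> {linear A -> A}.
Hypothesis dM : forall i P Q, d i (P * Q) = d i P * Q + P * d i Q.
Hypothesis dp : forall i j, d i (p j) = (i == j)%:R.

Let d1 i : d i 1 = 0.
Proof.
have := dM i 1 1; rewrite !mulr1 mul1r => /eqP.
by rewrite -subr_eq0 opprD addNKr oppr_eq0 => /eqP.
Qed.

Let dZ i (c : F) (P : A) : d i (c *: P) = c *: d i P.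
Proof. exact: linearZZ. Qed.

(** The classical n dh_k/dp_n = h_(k-n). In the derivative of Newton's identity for k h_k, the terms
    keeping p_l form Newton's identity for h_(k-n), with factor k - n; the term differentiating p_n
    supplies the missing n. *)
Lemma deriv_hsym i k : i.+1%:R *: d i (hsym k) = hsym (k - i.+1%:Z).
Proof.
have [k0|] := ltP k 0; first by rewrite !hsym_lt0 ?linear0 ?scaler0 //; lia.
case: k => // n _; have [b] := ubnP n; elim: b n => // b IH [|n] nb.
  by rewrite hsym0 d1 scaler0 hsym_lt0.
apply: (@scalerI _ _ n.+1%:R); first by rewrite pnatr_eq0.
rewrite scalerA mulrC -scalerA -dZ.
(* Large enough for Newton's identity in degree n + 1 and for the index [i] to lie in the window
   even when it exceeds n. *)
pose N := (n.+1 + i.+1)%N.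
rewrite -[n.+1%:R]/(n.+1%:Z%:~R) (@hsym_newton N); last by lia.
rewrite linear_sum scaler_sumr.
under eq_bigr => l _.
  rewrite dM dp scalerDr (scalerAr _ (p l)).
  rewrite (_ : i.+1%:R *: d i _ = hsym (n.+1%:Z - i.+1%:Z - l.+1%:Z)); last first.
    have [ln|nl] := leqP l.+1 n.+1.
      by rewrite subzn // IH; [congr hsym|]; lia.
    rewrite hsym_lt0; last by lia.
    by rewrite linear0 scaler0 hsym_lt0 //; lia.
  over.
rewrite big_split /= -hsym_newton; last by lia.
have iN : (i < N)%N by lia.
rewrite (bigD1 (Ordinal iN)) //= eqxx mul1r big1 ?addr0; last first.
  by move=> l; rewrite -val_eqE /= eq_sym => /negbTE ->; rewrite mul0r scaler0.
by rewrite -[i.+1%:R]/(i.+1%:Z%:~R) -scalerDl -intrD addrC subrK.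
Qed.

(** Euler equation of exp(- 2 sum_n y^n d/dp_n), the form of E^+(-alpha, x) once h(n) = 2 n d/dp_n
    is inserted. *)
Lemma htwist_deriv (N : nat) s l : l <= N%:Z ->
  l%:~R *: htwist s l =
  \sum_(i < N) (- 2 * i.+1%:R) *: d i (htwist s (l - i.+1%:Z)).
Proof.
elim: s l => [|k s IH] l lN.
  rewrite /= [RHS]big1 => [|i _]; last first.
    by rewrite [X in _ *: X](_ : _ = 0) ?scaler0 //; case: eqP; [rewrite d1|rewrite linear0].
  by case: eqVneq => [->|_]; rewrite ?scale0r ?scaler0.
(* Both indices move together along [g]: its values at l, l - 1, l - 2 are the three products
   defining the twist, and differentiating the [hsym] factor by [deriv_hsym] gives again a value of
   [g]. *)
pose g j := hsym (k - l + j) * htwist s j.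
have g0 j : j < 0 -> g j = 0 by move=> j0; rewrite /g htwist_lt0 ?mulr0.
have step (m : int) : m <= l -> \sum_(i < N) (- 2 * i.+1%:R) *:
    d i (hsym (k - l + m) * htwist s (m - i.+1%:Z)) =
    m%:~R *: g m - 2 *: \sum_(i < N) g (m - i.+1%:Z).
  move=> ml; rewrite scaler_sumr -sumrN {1}/g scalerAr IH; last by lia.
  rewrite mulr_sumr -big_split; apply: eq_bigr => i _ /=.
  rewrite dM scalerDr [LHS]addrC scalerAr; congr (_ + _).
  rewrite -scalerA scalerAl deriv_hsym scaleNr; congr (- (_ *: _)).
  by rewrite /g; congr (hsym _ * htwist s _); lia.
have l1 : l - 1 <= l by lia.
have l2 : l - 2 <= l by lia.
have E (i : 'I_N) : (- 2 * i.+1%:R) *: d i (htwist (k :: s) (l - i.+1%:Z)) =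
    (- 2 * i.+1%:R) *: d i (hsym (k - l + l) * htwist s (l - i.+1%:Z)) -
    2 *: ((- 2 * i.+1%:R) *: d i (hsym (k - l + (l - 1)) * htwist s (l - 1 - i.+1%:Z))) +
    (- 2 * i.+1%:R) *: d i (hsym (k - l + (l - 2)) * htwist s (l - 2 - i.+1%:Z)).
  rewrite /= !addrA !subrK (addrAC l _ (- 1)) (addrAC l _ (- 2)).
  rewrite linearD linearB dZ /= scalerDr scalerBr.
  by rewrite [X in _ - X]scalerA [X in _ - X *: _]mulrC -[X in _ - X]scalerA.
rewrite (eq_bigr _ (fun i _ => E i)) big_split sumrB -scaler_sumr /=.
rewrite (step l) // (step _ l1) (step _ l2).
have -> : hsym k * htwist s l = g l by rewrite /g subrK.
have -> : hsym (k - 1) * htwist s (l - 1) = g (l - 1).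
  by rewrite /g; congr (hsym _ * _); lia.
have -> : hsym (k - 2) * htwist s (l - 2) = g (l - 2).
  by rewrite /g; congr (hsym _ * _); lia.
rewrite (sum_shift g0 lN) (sum_shift g0 (l := l - 1)); last by lia.
have -> : l - 1 - 1 = l - 2 by lia.
set S := \sum_(i < N) _.
rewrite !intrB; exact: second_difference.
Qed.

End CompleteSymmetric.

(** * Power sums with prescribed complete functions *)

Section PowerSumsFromComplete.
Variables (F : numFieldType) (A : comAlgType F) (e : nat -> A).

(** Newton's identities solved for the power sums, with [e m] as h_(m+1). A list is built because
    each new term uses all earlier ones. *)
Fixpoint newton_seq n : seq A :=
  if n is m.+1 then
    let s := newton_seq m in
    rcons s (m.+1%:R *: e m - \sum_(i < m) s`_i * e (m - i.+1)%N)
  else [::].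

Lemma exists_power_sums : exists p : nat -> A, forall n, hsym p n.+1 = e n.
Proof.
pose p i := (newton_seq i.+1)`_i.
have size_newton n : size (newton_seq n) = n.
  by elim: n => //= n IH; rewrite size_rcons IH.
have nth_newton n i : (i < n)%N -> (newton_seq n)`_i = p i.
  elim: n => // n IH; rewrite ltnS leq_eqVlt => /orP[/eqP-> //|lin].
  by rewrite /= nth_rcons size_newton lin IH.
exists p => n; pose u (k : int) := if k is Posz k' then if k' is k''.+1 then e k'' else 1 else 0.
apply: (@hsym_unique _ _ _ u) => [[]//|//|[|m]]; first by rewrite scale0r big_ord0.
rewrite big_ord_recr /= subrr mulr1 {2}/p /= nth_rcons size_newton ltnn eqxx.
rewrite addrC -[LHS](subrK (\sum_(i < m) (newton_seq m)`_i * e (m - i.+1)%N)).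
congr (_ + _); apply: eq_bigr => i _; rewrite nth_newton //; congr (_ * _).
rewrite subzn /u; last by rewrite ltnS ltnW.
by rewrite subSn.
Qed.

End PowerSumsFromComplete.

Lemma hsym_morph (F : numFieldType) (A B : comAlgType F) (p : nat -> A)
    (q : nat -> B) (f : {linear A -> B}) :
    f 1 = 1 -> {morph f : P Q / P * Q} -> (forall i, f (p i) = q i) ->
  forall k, f (hsym p k) = hsym q k.
Proof.
move=> f1 fM fpq k; apply/esym; apply: (hsym_unique (u := f \o hsym p)) => [l l0||n] /=.
- by rewrite hsym_lt0 ?linear0.
- by rewrite hsym0.
- rewrite -linearZZ -[n%:R]/(n%:Z%:~R) (@hsym_newton _ _ _ n) // linear_sum.
  by apply: eq_bigr => i _; rewrite fM fpq.
Qed.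

(** * The polynomial algebra M(1): derivations, grading, evaluation, independence of the h_k *)

Section BilinearMaps.
Variables (F : fieldType) (A B : comAlgType F) (f : {linear A -> B}).

(** This and the next linearity facts reduce multiplicativity and the Leibniz rule to pairs of
    monomials, one argument at a time. *)
Lemma linear_mull Q : linear (fun P => f (P * Q)).
Proof. by move=> c u v; rewrite mulrDl -scalerAl linearP. Qed.

Lemma linear_mulr Q : linear (fun P => f (Q * P)).
Proof. by move=> c u v; rewrite mulrDr -scalerAr linearP. Qed.

Lemma mull_linear Q : linear (fun P => f P * Q).
Proof. by move=> c u v; rewrite linearP mulrDl -scalerAl. Qed.

Lemma mulr_linear Q : linear (fun P => Q * f P).
Proof. by move=> c u v; rewrite linearP mulrDr -scalerAr. Qed.

End BilinearMaps.

Section Leibniz.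
Variables (F : fieldType) (A : comAlgType F) (f : {linear A -> A}).

Lemma leibniz_linearl Q : linear (fun P => f P * Q + P * f Q).
Proof.
by move=> c u v; rewrite linearP !mulrDl -!scalerAl scalerDr addrACA.
Qed.

Lemma leibniz_linearr Q : linear (fun P => f Q * P + Q * f P).
Proof.
by move=> c u v; rewrite linearP !mulrDr -!scalerAr scalerDr addrACA.
Qed.

End Leibniz.

Section Polynomials.
Variable F : numFieldType.
Local Notation A := {malg F[{cmonom nat}]}.
Implicit Types (P Q : A) (m : {cmonom nat}).

Lemma malgUM m1 m2 : << m1 >> * << m2 >> = << mmul m1 m2 >> :> A.
Proof. by rewrite malgM_def fgmulUU mulr1. Qed.

(** The variable h(-(i+1)), of degree i + 1. *)
Definition psum (i : nat) : A := << ucm i >>.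

Definition pderiv (i : nat) : A -> A :=
  mext (fun m : {cmonom nat} => (m i)%:R *: (<< divcm m (ucm i) >> : A)).
HB.instance Definition _ i := GRing.Linear.on (pderiv i).

Lemma pderivU i m : pderiv i << m >> = (m i)%:R *: << divcm m (ucm i) >>.
Proof. exact: mextU. Qed.

Lemma divcmM i m1 m2 : m1 i != 0%N ->
  divcm (mmul m1 m2) (ucm i) = mmul (divcm m1 (ucm i)) m2.
Proof.
move=> m1i; apply/eqP/cmP => j; rewrite divcmE !cmM divcmE cmU.
by have [<-|] := eqVneq i j; lia.
Qed.

Lemma pderivUM i m1 m2 :
  pderiv i (<< m1 >> * << m2 >>) =
  pderiv i << m1 >> * << m2 >> + << m1 >> * pderiv i << m2 >>.
Proof.
have -> : pderiv i (<< m1 >> * << m2 >>) =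
    (m1 i)%:R *: << divcm (mmul m1 m2) (ucm i) >> +
    (m2 i)%:R *: << divcm (mmul m1 m2) (ucm i) >>.
  by rewrite malgUM pderivU cmM natrD; apply: scalerDl.
(* The division of monomials is truncated: when a factor has exponent 0 at [i], its half of the sum
   vanishes through the coefficient instead. *)
congr (_ + _); rewrite pderivU.
  apply: etrans (scalerAl _ _ _); rewrite malgUM.
  have [->|m1i] := eqVneq (m1 i) 0%N; last by rewrite (divcmM _ m1i).
  exact: etrans (scale0r _) (esym (scale0r _)).
apply: etrans (GRing.scalerAr _ _ _); rewrite malgUM.
have [->|m2i] := eqVneq (m2 i) 0%N.
  exact: etrans (scale0r _) (esym (scale0r _)).
by rewrite mulmC (divcmM _ m2i) mulmC.
Qed.

Lemma pderivM i P Q : pderiv i (P * Q) = pderiv i P * Q + P * pderiv i Q.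
Proof.
move: P; apply: malg_linear_ext (linear_mull (pderiv i) Q) (leibniz_linearl (pderiv i) Q) _ => m1.
move: Q; apply: malg_linear_ext (linear_mulr (pderiv i) _) (leibniz_linearr (pderiv i) _) _ => m2.
exact: pderivUM.
Qed.

Lemma pderiv_psum i j : pderiv i (psum j) = (i == j)%:R.
Proof.
rewrite pderivU cmU eq_sym; have [->|_] := eqVneq i j; last by rewrite scale0r.
rewrite scale1r; congr (<< _ >> : A); apply/eqP/cmP => k.
by rewrite divcmE subnn cm1.
Qed.

Definition cmweight m : nat := \sum_(i <- finsupp m) i.+1 * m i.

Lemma cmweightEw (d : {fset nat}) m : (finsupp m `<=` d)%fset ->
  cmweight m = (\sum_(i <- d) i.+1 * m i)%N.
Proof.
move=> le; rewrite /cmweight (big_fset_incl _ le) //.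
by move=> i _; rewrite -cmE_neq0 negbK => /eqP ->; rewrite muln0.
Qed.

Lemma cmweightM m1 m2 : cmweight (mmul m1 m2) = (cmweight m1 + cmweight m2)%N.
Proof.
rewrite {1}/cmweight mdomD (cmweightEw (fsubsetUl _ (finsupp m2))).
rewrite (cmweightEw (fsubsetUr (finsupp m1) _)) -big_split /=.
by apply: eq_bigr => i _; rewrite cmM mulnDr.
Qed.

Definition homog (k : int) P := forall m, m \in msupp P -> (cmweight m)%:Z = k.

Lemma homog_lspan k P : lspan (homog k) P -> homog k P.
Proof.
case=> n [c [a [ha ->]]] m.
rewrite -mcoeff_neq0 raddf_sum /= => mP.
have [i mi] : exists i, (a i)@_m != 0.
  apply: contrapT => H; move: mP; rewrite big1 ?eqxx // => i _.
  rewrite (mcoeffZ (c i) (a i)); have [->|ai] := eqVneq (a i)@_m 0; first by rewrite mulr0.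
  by case: H; exists i.
by apply: (ha i); rewrite -mcoeff_neq0.
Qed.

Lemma homog1 : homog 0 1.
Proof.
move=> m; rewrite -mcoeff_neq0.
have -> : (1 : A)@_m = (m == mone)%:R by apply: mcoeff1.
have [->|_] := eqVneq m mone; last by rewrite eqxx.
by rewrite /cmweight mdom1 big_seq_fset0.
Qed.

Lemma homogM j k P Q : homog j P -> homog k Q -> homog (j + k) (P * Q).
Proof.
move=> hP hQ m /msuppM_le[m1 [m2 [m1P m2Q ->]]].
by rewrite cmweightM PoszD (hP _ m1P) (hQ _ m2Q).
Qed.

Lemma homog_psum (i : nat) : homog i.+1 (psum i).
Proof.
move=> m; rewrite -mcoeff_neq0.
have -> : (psum i)@_m = (ucm i == m)%:R by apply: mcoeffU1.
have [<-|_] := eqVneq (ucm i) m; last by rewrite eqxx.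
by rewrite /cmweight mdomU big_seq_fset1 cmUU muln1.
Qed.

Section Evaluation.
Variable S : comAlgType F.

Definition meval (v : nat -> S) : A -> S :=
  mext (fun m : {cmonom nat} => \prod_(i <- finsupp m) v i ^+ m i).
HB.instance Definition _ v := GRing.Linear.on (meval v).

Lemma mevalU v (d : {fset nat}) m : (finsupp m `<=` d)%fset ->
  meval v << m >> = \prod_(i <- d) v i ^+ m i.
Proof.
move=> le; rewrite [LHS]mextU (big_fset_incl _ le) //.
by move=> i _; rewrite -cmE_neq0 negbK => /eqP ->.
Qed.

Lemma mevalUM v m1 m2 :
  meval v (<< m1 >> * << m2 >>) = meval v << m1 >> * meval v << m2 >>.
Proof.
apply: etrans (congr1 (meval v) (malgUM m1 m2)) _.
have le : (finsupp (mmul m1 m2) `<=` finsupp m1 `|` finsupp m2)%fset by rewrite mdomD.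
have e1 := mevalU v (fsubsetUl (finsupp m1) (finsupp m2)).
have e2 := mevalU v (fsubsetUr (finsupp m1) (finsupp m2)).
refine (etrans (mevalU v le) (etrans _ (esym (congr2 (fun x y : S => x * y) e1 e2)))).
rewrite -big_split /=.
by apply: eq_bigr => i _; rewrite cmM exprD.
Qed.

Lemma mevalM v : {morph meval v : P Q / P * Q}.
Proof.
move=> P Q; move: P.
apply: malg_linear_ext (linear_mull (meval v) Q) (mull_linear (meval v) _) _ => m1.
move: Q; apply: malg_linear_ext (linear_mulr (meval v) _) (mulr_linear (meval v) _) _ => m2.
exact: mevalUM.
Qed.

Lemma meval1 v : meval v 1 = 1.
Proof. by rewrite [LHS]mextU mdom1 big_seq_fset0. Qed.

Lemma meval_psum v i : meval v (psum i) = v i.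
Proof. by rewrite [LHS]mextU mdomU big_seq_fset1 cmUU. Qed.

End Evaluation.

(** Zeros are dropped because h_0 = 1; h_k with k > 0 corresponds to the variable of index k - 1. *)
Definition mon_of (s : seq nat) : {cmonom nat} :=
  \big[mmul/mone]_(k <- s | (0 < k)%N) ucm k.-1.

Lemma mon_ofE s i : mon_of s i = count_mem i.+1 s.
Proof.
rewrite /mon_of; elim: s => [|k s IH]; first by rewrite big_nil cm1.
rewrite big_cons; case: k => [|k] /=; first by rewrite IH.
by rewrite cmM IH cmU eqSS.
Qed.

(** The exponents count the positive entries, and the number of zeros is the size minus the
    degree. *)
Lemma mon_of_perm s t : size s = size t -> mon_of s = mon_of t -> perm_eq s t.
Proof.
move=> st mst; apply/allP => -[|i] _ /=; last by rewrite -!mon_ofE mst.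
have szE u : count_mem 0%N u = (size u - mdeg (mon_of u))%N.
  rewrite -(count_predC (pred1 0%N) u) mdeg_prod.
  rewrite (eq_bigr (fun=> 1%N)) => [|k _]; last exact: mdegU.
  rewrite sum1_count (_ : count (leq 1) u = count (predC (pred1 0%N)) u) ?addnK //.
  by apply: eq_count => -[].
by rewrite !szE st mst.
Qed.

Local Notation hprodn s := (hprod psum (map Posz s)).

(* The h_k (k > 0) are algebraically independent: some endomorphism of the
   polynomial algebra maps h_(k+1) to the k-th variable. *)
Lemma hprod_free n (s : 'I_n -> seq nat) :
    (forall i j, size (s i) = size (s j)) ->
    (forall i j, perm_eq (s i) (s j) -> i = j) ->
  lfree (fun i => hprodn (s i)).
Proof.
move=> ss sinj c c0 i.
have [v hv] := exists_power_sums psum.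
have ev := hsym_morph (meval1 v) (@mevalM _ v) (@meval_psum _ v).
have evh t : meval v (hprodn t) = << mon_of t >>.
  elim: t => [|k t IH].
    by rewrite /hprod /mon_of !big_nil; apply: meval1.
  have -> : hprodn (k :: t) = hsym psum k * hprodn t by apply: big_cons.
  apply: etrans (mevalM v _ _) _.
  apply: etrans (congr2 (fun P Q : A => P * Q) (ev k) IH) _.
  rewrite /mon_of big_cons; case: k => [|k] /=.
    exact: etrans (congr1 (fun P : A => P * _) (hsym0 v)) (mul1r _).
  exact: etrans (congr1 (fun P : A => P * _) (hv k)) (malgUM _ _).
have mU (j j' : 'I_n) : (meval v (hprodn (s j)))@_(mon_of (s j')) = (j == j')%:R.
  apply: etrans (congr1 (mcoeff _) (evh _)) _.
  apply: etrans (mcoeffU1 _ _ _) _; congr (nat_of_bool _)%:R.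
  by apply/eqP/eqP => [/mon_of_perm|->//]; move/(_ (ss _ _))/sinj.
pose ce P := (meval v P)@_(mon_of (s i)).
have ceZ j P : ce (c j *: P) = c j * ce P.
  exact: etrans (congr1 (mcoeff _) (linearZZ (meval v) _ _)) (mcoeffZ _ _ _).
have ce_sum : ce (\sum_(j < n) c j *: hprodn (s j)) = \sum_(j < n) c j * (j == i)%:R.
  apply: etrans (congr1 (mcoeff _) (linear_sum (meval v) _ _ _)) _.
  apply: etrans (raddf_sum (mcoeff _) _ _ _) _; apply: eq_bigr => j _.
  by apply: etrans (ceZ j _) _; congr (_ * _); apply: mU.
have ce0 : ce 0 = 0.
  exact: etrans (congr1 (mcoeff _) (linear0 (meval v))) (mcoeff0 _).
move: ce_sum; rewrite c0 ce0 (bigD1 i) //= eqxx mulr1 big1 ?addr0 => [->//|j ji].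
by rewrite (negbTE ji) mulr0.
Qed.

End Polynomials.

(** * Linearity, finite windows, exponentials of commuting families *)

Section LinearClosure.
Variables (F : fieldType) (U V W : lmodType F).

Lemma comp_linear (f : V -> W) (g : U -> V) :
  linear f -> linear g -> linear (fun v => f (g v)).
Proof. by move=> lf lg c u v; rewrite lg lf. Qed.

Lemma scale_linear (a : F) (f : U -> V) : linear f -> linear (fun v => a *: f v).
Proof. by move=> lf c u v; rewrite lf scalerDr !scalerA mulrC. Qed.

Lemma linear_0 (f : U -> V) : linear f -> f 0 = 0.
Proof.
by move=> lf; have := lf (- 1) 0 0; rewrite !scaleN1r oppr0 addr0 addNr.
Qed.

Lemma linear_lincomb (f : U -> V) n (c : 'I_n -> F) (u : 'I_n -> U) :
  linear f -> f (\sum_(i < n) c i *: u i) = \sum_(i < n) c i *: f (u i).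
Proof.
move=> lf; elim: n c u => [|n IH] c u; first by rewrite !big_ord0 linear_0.
by rewrite !big_ord_recl lf IH.
Qed.

Lemma mul_linear (A : comAlgType F) (a : A) : linear ( *%R a).
Proof. by move=> c u v; rewrite mulrDr -scalerAr. Qed.

End LinearClosure.

Lemma ops_mul_single (F : fieldType) (V : lmodType F) (a b : opseries V) k i v :
  (forall j, j != i -> a j (b (k - j) v) = 0) ->
  ops_mul a b k v = a i (b (k - i) v).
Proof.
move=> ab0; rewrite /ops_mul (fsbigE [:: i]) //=; last first.
  by move=> j _; rewrite inE => /ab0.
by rewrite big_cons big_nil in_setT addr0.
Qed.

Lemma fsbig_window (V : zmodType) (f : int -> V) (M : int) (N : nat) :
  (forall i, (i < M) || (M + N%:Z < i) -> f i = 0) ->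
  \sum_(i \in [set: int]) f i = \sum_(l < N.+1) f (M + l%:Z).
Proof.
move=> f0; rewrite -(big_mkord xpredT (fun l => f (M + l%:Z))).
rewrite -(big_map (fun l : nat => M + l%:Z) xpredT f).
rewrite (fsbigE [seq M + l%:Z | l <- index_iota 0 N.+1]) //; last first.
- move=> i _ iN; apply: f0; apply: contraNT iN.
  rewrite negb_or -!leNgt => /andP[i0 iN]; apply/mapP.
  by exists `|i - M|%N; rewrite ?mem_index_iota; lia.
- by rewrite map_inj_uniq ?iota_uniq // => i j; lia.
- by rewrite big_seq_cond [RHS]big_seq_cond; apply: eq_bigl => i; rewrite andbT andbC in_setT.
Qed.

Section CommutingFamily.
Variables (F : numFieldType) (V : lmodType F) (h : nat -> V -> V).
Hypothesis h_linear : forall i, linear (h i).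
Hypothesis h_comm : forall i j v, h i (h j v) = h j (h i v).

HB.instance Definition _ i := GRing.isLinear.Build F V V *:%R (h i) (h_linear i).

Let hZ i a v : h i (a *: v) = a *: h i v.
Proof. exact: linearZZ. Qed.

Definition log_series (c : F) : opseries V := fun k v =>
  if k is Posz i.+1 then (c / i.+1%:R) *: h i v else 0.

Let lin c k : linear (log_series c k).
Proof.
by case: k => [[|i]|i] a u v /=; rewrite ?scaler0 ?addr0 // linearP scalerDr !scalerA mulrC.
Qed.

Let supp c k v : k <= 0 -> log_series c k v = 0.
Proof. by case: k => [[|i]|i]. Qed.

Let comm c i j v : log_series c i (log_series c j v) = log_series c j (log_series c i v).
Proof.
case: i => [[|i]|i]; case: j => [[|j]|j]; rewrite /= ?linear0 ?scaler0 //.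
by rewrite !hZ h_comm !scalerA mulrC.
Qed.

Lemma exp_log_unique c (u : int -> V) :
  (forall k, k < 0 -> u k = 0) ->
  (forall N : nat,
     N%:R *: u N = \sum_(i < N) c *: h i (u (N%:Z - i.+1%:Z))) ->
  forall k, ops_exp (log_series c) k (u 0) = u k.
Proof.
move=> u_lt0 uS; apply: (ops_exp_unique (lin c) (@supp c) (comm c) u_lt0) => N.
rewrite uS; apply: eq_bigr => i _ /=.
by rewrite scalerA mulrCA mulfV ?mulr1 // pnatr_eq0.
Qed.

(** By uniqueness: a E x + E y satisfies the recursion with initial vector a x + y. *)
Lemma exp_log_linear c k : linear (ops_exp (log_series c) k).
Proof.
move=> a x y; pose E := ops_exp (log_series c).
pose u l := a *: E l x + E l y.
have E0 v : E 0 v = v by apply: (ops_exp0 (lin c) (@supp c)).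
have {1}-> : a *: x + y = u 0 by rewrite /u !E0.
apply: (ops_exp_unique (lin c) (@supp c) (comm c) (u := u)) => [l l0|N].
  by rewrite /u /E !(ops_exp_lt0 (lin c) (@supp c)) // scaler0 addr0.
have dE v : N%:R *: E N v = _ := ops_exp_deriv (lin c) (@supp c) (comm c) v (lexx N%:Z).
rewrite /u scalerDr dE scalerA mulrC -scalerA dE scaler_sumr -big_split.
apply: eq_bigr => i _; rewrite lin scalerDr; congr (_ + _).
by rewrite !scalerA [a * _]mulrC.
Qed.

End CommutingFamily.

(** * Heisenberg and vertex operators on M(1) (x) e^(c alpha) *)

Section FockSpace.
Variable R : realType.
Local Notation C := R[i].
Local Notation A := {malg C[{cmonom nat}]}.
Local Notation VQ := {malg C[VQbasis]}.

Lemma bvecE b b' : (bvec R b)@_b' = (b == b')%:R.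
Proof. exact: mcoeffU. Qed.

Definition tens (c : int) : A -> VQ := mext (fun m : {cmonom nat} => bvec R (m, c)).
HB.instance Definition _ c := GRing.Linear.on (tens c).

Lemma tensU c m : tens c << m >> = bvec R (m, c).
Proof. exact: mextU. Qed.

Lemma tens_linear c : linear (tens c).
Proof. exact: linearP. Qed.

Lemma tensZ c a P : tens c (a *: P) = a *: tens c P.
Proof. exact: linearZZ. Qed.

Lemma tens_sum c (I : Type) (r : seq I) (p : pred I) (E : I -> A) :
  tens c (\sum_(i <- r | p i) E i) = \sum_(i <- r | p i) tens c (E i).
Proof. exact: linear_sum. Qed.

Lemma tensD c P Q : tens c (P + Q) = tens c P + tens c Q.
Proof. exact: linearD. Qed.

Lemma tens0 c : tens c 0 = 0.
Proof. exact: linear0. Qed.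

Lemma tens_coef c P m : (tens c P)@_(m, c) = P@_m.
Proof.
move: P; pose cf (b : VQbasis) := fun v : VQ => (mcoeff b v : C^o).
have cfL b : linear (cf b) by move=> a u v; rewrite /cf mcoeffD (mcoeffZ a u).
have cfL' b : linear (fun P : A => mcoeff b P : C^o).
  by move=> a u v; rewrite mcoeffD (mcoeffZ a u).
apply: (malg_linear_ext (comp_linear (cfL (m, c)) (tens_linear c)) (cfL' m)) => m'.
rewrite tensU /cf (_ : << m' >>@_m = (m' == m)%:R); last exact: mcoeffU1.
rewrite bvecE; congr (nat_of_bool _)%:R; by rewrite xpair_eqE eqxx andbT.
Qed.

Lemma tens_coef0 c P b : b.2 != c -> (tens c P)@_b = 0.
Proof.
move=> bc; move: P; pose cf (v : VQ) := (mcoeff b v : C^o).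
have cfL : linear cf by move=> a u v; rewrite /cf mcoeffD (mcoeffZ a u).
have zL : linear (fun P : A => 0 : C^o) by move=> a u v; rewrite scaler0 addr0.
apply: (malg_linear_ext (comp_linear cfL (tens_linear c)) zL) => m'.
rewrite tensU /cf bvecE.
by have [eb|//] := eqVneq (m', c) b; rewrite -eb eqxx in bc.
Qed.

Lemma lext_linear (f : VQbasis -> VQ) : linear (lext f).
Proof. exact: mext_is_linear. Qed.

Lemma lextU (f : VQbasis -> VQ) b : lext f (bvec R b) = f b.
Proof. exact: mextU. Qed.

Lemma heis_linear n : linear (@heis R n).
Proof. by case: n => [[|n]|n]; apply: lext_linear. Qed.

Lemma heis_pos n c P :
  heis n.+1 (tens c P) = (2 * n.+1%:R) *: tens c (pderiv n P).
Proof.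
move: P; apply: (malg_linear_ext (comp_linear (heis_linear _) (tens_linear c))
  (scale_linear _ (comp_linear (tens_linear c) (mext_is_linear _)))) => m.
rewrite tensU; apply: etrans (lextU _ _) _.
apply: etrans _ (congr1 (fun P : A => (2 * n.+1%:R) *: tens c P) (esym (pderivU _ _ _))).
by cbv beta; rewrite tensZ tensU scalerA !natrM.
Qed.

Lemma heis_neg n c P : heis (Negz n) (tens c P) = tens c (psum _ n * P).
Proof.
move: P; apply: (malg_linear_ext (comp_linear (heis_linear _) (tens_linear c))
  (comp_linear (tens_linear c) (mul_linear (psum _ n)))) => m.
rewrite tensU; apply: etrans (lextU _ _) _ => /=.
by apply: etrans (esym (tensU _ _)) (congr1 (tens c) (esym (malgUM _ _ _))).
Qed.

Lemma divcmC (m m1 m2 : {cmonom nat}) :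
  divcm (divcm m m1) m2 = divcm (divcm m m2) m1.
Proof. by apply/eqP/cmP => i; rewrite !divcmE subnAC. Qed.

Lemma heis_pos_comm (i j : nat) (v : VQ) :
  heis i.+1 (heis j.+1 v) = heis j.+1 (heis i.+1 v).
Proof.
have L n k := comp_linear (heis_linear n) (heis_linear k).
move: v; apply: (malg_linear_ext (L i.+1 j.+1) (L j.+1 i.+1)) => b.
have hb (n : nat) b' : heis n.+1 (bvec R b') =
    (2 * n.+1 * b'.1 n)%:R *: bvec R (divcm b'.1 (ucm n), b'.2) by apply: lextU.
have hZ n a b' : heis n (a *: bvec R b') = a *: heis n (bvec R b').
  pose h := GRing.isLinear.Build _ _ _ _ (@heis R n) (heis_linear n).
  pose H : {linear VQ -> VQ} := HB.pack (@heis R n) h.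
  exact: (linearZZ H).
rewrite -/(bvec R b) (hb i b) (hb j b) !hZ !hb /= !scalerA divcmC.
have [->//|ij] := eqVneq i j; rewrite !divcmE !cmU.
rewrite (negbTE ij) [j == i]eq_sym (negbTE ij) !subn0; congr (_ *: _).
exact: mulrC.
Qed.

Lemma e_op_tens d c P : e_op d (tens c P) = tens (d + c) P.
Proof.
move: P; apply: (malg_linear_ext (comp_linear (lext_linear _) (tens_linear c))
  (tens_linear _)) => m.
by rewrite !tensU; apply: lextU.
Qed.

Lemma e_op0 d : @e_op R d 0 = 0.
Proof.
have := linear_0 (lext_linear (fun b : VQbasis => bvec R (b.1, d + b.2))).
by apply.
Qed.

Lemma x_op_tens d k c P :
  x_op d k (tens c P) = if k == Qform d c then tens c P else 0.
Proof.
move: P; apply: (malg_linear_ext (comp_linear (lext_linear _) (tens_linear c))) => [|m].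
  by case: eqP => _; [apply: tens_linear|move=> a u v; rewrite scaler0 addr0].
by rewrite tensU; apply: lextU.
Qed.

Lemma heis_neg_comm (i j : nat) (v : VQ) :
  heis (Negz i) (heis (Negz j) v) = heis (Negz j) (heis (Negz i) v).
Proof.
have L n k := comp_linear (heis_linear n) (heis_linear k).
move: v; apply: (malg_linear_ext (L (Negz i) (Negz j)) (L (Negz j) (Negz i))) => b.
have hb (n : nat) b' : heis (Negz n) (bvec R b') = bvec R (mmul (ucm n) b'.1, b'.2).
  exact: lextU.
apply: etrans (congr1 (heis (Negz i)) (hb j b)) (etrans (hb i _) _).
apply: esym; apply: etrans (congr1 (heis (Negz j)) (hb i b)) (etrans (hb j _) _).
apply: (congr1 (fun m => bvec R (m, b.2))).
apply: etrans (mulmA _ _ _) (etrans _ (esym (mulmA _ _ _))).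
exact: (congr1 (mmul^~ b.1) (mulmC _ _)).
Qed.

Section Vertex.
Local Notation hsym := (hsym (psum C)).
Local Notation hprod := (hprod (psum C)).
Local Notation htwist := (htwist (psum C)).

(** At x^k the coefficient is - h(-k) / (- k): the two signs cancel, hence the parameter 1. In
    [EplusE] a single sign survives, hence - 1. *)
Lemma EminusE :
  @Eminus R (- 1) = ops_exp (log_series (fun i => heis (Negz i)) 1).
Proof.
rewrite /Eminus; congr ops_exp; apply/funext => k; apply/funext => v.
case: k => [[|i]|i].
- by [].
- rewrite /log_series /lat (_ : - i.+1%:Z <= - 1 = true); last by lia.
  rewrite -NegzE; apply: etrans (scalerA _ _ _) _; congr (_ *: _).
  by rewrite NegzE !mulrNz invrN mulrNN mulr1 mul1r.
- by [].
Qed.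

Lemma EplusE k v :
  @Eplus R (- 1) (- k) v =
  ops_exp (log_series (fun i => heis i.+1) (- 1)) k v.
Proof.
rewrite /Eplus; apply: etrans (ops_exp_opp _ _ _) _.
apply: (congr1 (fun a => ops_exp a k v)).
apply/funext => l; apply/funext => u.
rewrite opprK; case: l => [[|i]|i].
- by [].
- rewrite /log_series /lat; apply: etrans (scalerA _ _ _) _.
  by congr (_ *: _); apply: mulrC.
- by [].
Qed.

Lemma Eminus_tens k c P : Eminus (- 1) k (tens c P) = tens c (hsym k * P).
Proof.
pose u l := tens c (hsym l * P).
have u0 : u 0 = tens c P by congr (tens c _); apply: hsym0M.
rewrite EminusE -u0 -[RHS]/(u k).
apply: exp_log_unique => [i|i j v|l l0|N].
- exact: heis_linear.
- exact: heis_neg_comm.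
- exact: etrans (congr1 (tens c) (hsym_lt0M (psum C) _ l0)) (tens0 c).
- apply: etrans (esym (tensZ _ _ _)) _.
  apply: etrans (congr1 (tens c) (hsym_newtonM (psum C) N P)) _.
  rewrite tens_sum; apply: eq_bigr => i _.
  exact: esym (etrans (scale1r _) (heis_neg _ _ _)).
Qed.

Lemma Eplus_tens s l c : Eplus (- 1) (- l) (tens c (hprod s)) = tens c (htwist s l).
Proof.
pose u j := tens c (htwist s j).
have u0 : u 0 = tens c (hprod s) by congr (tens c _); apply: htwist0.
rewrite EplusE -u0 -[RHS]/(u l).
apply: exp_log_unique => [i|i j v|j j0|N].
- exact: heis_linear.
- exact: heis_pos_comm.
- exact: etrans (congr1 (tens c) (htwist_lt0 (psum C) s j0)) (tens0 c).
- apply: etrans (esym (tensZ _ _ _)) _.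
  have dE := htwist_deriv (@pderivM C) (@pderiv_psum C) s (lexx N%:Z).
  apply: etrans (congr1 (tens c) dE) _.
  rewrite tens_sum; apply: eq_bigr => i _; rewrite /u heis_pos tensZ.
  apply: etrans _ (esym (scalerA _ _ _)).
  by congr (_ *: _); rewrite mulN1r mulNr.
Qed.

Lemma Eplus_linear k : linear (@Eplus R (- 1) k).
Proof.
move=> a x y; rewrite -[k]opprK !EplusE.
exact: exp_log_linear (fun i => heis_linear i.+1) heis_pos_comm _ _ a x y.
Qed.

Definition e_x_op : opseries VQ := ops_mul (ops_const (@e_op R 1)) (@x_op R 1).

Lemma e_x_tens k c P :
  e_x_op k (tens c P) = if k == Qform 1 c then tens (1 + c) P else 0.
Proof.
apply: etrans (@ops_mul_single _ _ (ops_const (@e_op R 1)) (@x_op R 1) k 0 _ _) _.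
  by move=> j /negbTE j0; rewrite /ops_const j0.
rewrite subr0; apply: etrans (congr1 (@e_op R 1) (x_op_tens _ _ _ _)) _.
by case: (k == Qform 1 c); [apply: e_op_tens|apply: e_op0].
Qed.

Lemma Eplus_e_x_tens k c P :
  ops_mul (Eplus (- 1)) e_x_op k (tens c P) =
  Eplus (- 1) (k - Qform 1 c) (tens (1 + c) P).
Proof.
have kc : k - (k - Qform 1 c) = Qform 1 c by lia.
apply: etrans (@ops_mul_single _ _ (Eplus (- 1)) e_x_op k (k - Qform 1 c) _ _) _.
  move=> j jk; rewrite e_x_tens; case: eqP => [jE|_].
    by case/eqP: jk; rewrite -jE; lia.
  exact: linear_0 (Eplus_linear j).
by rewrite kc e_x_tens eqxx.
Qed.

(* T l is the coefficient of x^(-l) in E^+(-alpha, x) P. *)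
Definition twist_of (P : A) (T : int -> A) (N : nat) :=
  (forall c l, Eplus (- 1) (- l) (tens c P) = tens c (T l)) /\
  (forall l : int, (l < 0) || (N%:Z < l) -> T l = 0).

(** Exponents are balanced: x^alpha contributes 2 c, E^+ contributes - l, and E^- must supply - m -
    1 - 2 c + l. The finite support of [T] makes the sum over the integers finite. *)
Lemma x_alphaE m c P T N : twist_of P T N ->
  x_alpha m (tens c P) =
  tens (1 + c) (\sum_(l < N.+1) hsym (- m - 1 - Qform 1 c + l%:Z) * T l).
Proof.
move=> [ET T0]; rewrite /x_alpha /Y -/e_x_op; set k := - m - 1.
have term i : Eminus (- 1) i (ops_mul (Eplus (- 1)) e_x_op (k - i) (tens c P)) =
    tens (1 + c) (hsym i * T (i - (k - Qform 1 c))).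
  apply: etrans (congr1 (Eminus (- 1) i) (Eplus_e_x_tens _ _ _)) _.
  have -> : k - i - Qform 1 c = - (i - (k - Qform 1 c)) by lia.
  by rewrite ET Eminus_tens.
set M := k - Qform 1 c.
transitivity (\sum_(i \in [set: int]) tens (1 + c) (hsym i * T (i - M))).
  by apply: eq_fsbigr => i _; apply: term.
apply: etrans (fsbig_window (M := M) (N := N) _) _.
  move=> i iN; rewrite T0; first by rewrite mulr0 tens0.
  by move: iN; rewrite !ltNge; lia.
rewrite tens_sum; apply: eq_bigr => l _.
by have -> : M + l%:Z - M = l%:Z by lia.
Qed.

End Vertex.
End FockSpace.

(** * The principal subspace in terms of the spans M_r *)

Section Spans.
Variables (K : fieldType) (V : lmodType K).
Implicit Types A B : set V.

Lemma lspan0 A : lspan A 0.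
Proof. by exists 0%N, (fun=> 0), (fun=> 0); rewrite big_ord0; split=> // -[]. Qed.

Lemma lspanD A u v : lspan A u -> lspan A v -> lspan A (u + v).
Proof.
move=> Au Av; have := @lspan_sum _ _ A bool [:: true; false] xpredT
  (fun b : bool => if b then u else v).
by rewrite !big_cons big_nil addr0; apply=> -[].
Qed.

Lemma lspanB A u v : lspan A u -> lspan A v -> lspan A (u - v).
Proof. by move=> Au Av; rewrite -scaleN1r; apply/lspanD/lspanZ. Qed.

Lemma lspan_subset A B : A `<=` lspan B -> lspan A `<=` lspan B.
Proof.
move=> AB _ [n [c [a [Aa ->]]]].
by apply: lspan_sum => i _; apply/lspanZ/AB.
Qed.

End Spans.

Lemma exchange_lincomb (F : fieldType) (A : comAlgType F) (N n : nat)
    (a : 'I_N -> A) (d : 'I_n -> F) (T : 'I_n -> 'I_N -> A) :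
  \sum_(l < N) a l * (\sum_(i < n) d i *: T i l) =
  \sum_(i < n) d i *: \sum_(l < N) a l * T i l.
Proof.
under eq_bigr do rewrite mulr_sumr; rewrite exchange_big.
apply: eq_bigr => i _; rewrite scaler_sumr; apply: eq_bigr => l _.
by rewrite -scalerAr.
Qed.

Section CompleteSpan.
Variables (F : numFieldType) (A : comAlgType F) (p : nat -> A).

(** The space M_r. Entries are arbitrary integers: a zero contributes the factor 1, a negative one
    kills the product. *)
Definition hspan (r : nat) : set A :=
  lspan [set hprod p s | s in [set s | size s = r]].

Lemma hspan_hprod s : hspan (size s) (hprod p s).
Proof. by apply: lspan_sub; exists s. Qed.

Lemma hspan_hsymM r k P : hspan r P -> hspan r.+1 (hsym p k * P).
Proof.
move=> [n [c [f [fP ->]]]]; rewrite mulr_sumr; apply: lspan_sum => i _.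
rewrite -scalerAr; apply/lspanZ/lspan_sub.
by have [s <- <-] := fP i; exists (k :: s); rewrite // /hprod big_cons.
Qed.

(** A negative sum forces a negative entry. *)
Lemma hprod_lt0 s : \sum_(k <- s) k < 0 -> hprod p s = 0.
Proof.
elim: s => [|k s IH]; rewrite /hprod ?big_nil ?ltxx // !big_cons.
have [k0 _|k0 ks0] := ltP k 0; first by rewrite hsym_lt0 ?mul0r.
by rewrite -/(hprod p s) IH ?mulr0 //; move: (\sum_(j <- s) j) ks0 => x; lia.
Qed.

Lemma hprod_cons k s : hprod p (k :: s) = hsym p k * hprod p s.
Proof. exact: big_cons. Qed.

Lemma hprod_nil : hprod p [::] = 1.
Proof. exact: big_nil. Qed.

Lemma htwist_hspan s l : hspan (size s) (htwist p s l).
Proof.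
apply: lspan_subset (htwist_lspan p s l) => _ [s' [ss' _] <-].
by rewrite -ss'; apply: hspan_hprod.
Qed.

End CompleteSpan.

Section PrincipalSubspace.
Variable R : realType.
Local Notation C := R[i].
Local Notation A := {malg C[{cmonom nat}]}.
Local Notation VQ := {malg C[VQbasis]}.
Local Notation hsym := (hsym (psum C)).
Local Notation hprod := (hprod (psum C)).
Local Notation htwist := (htwist (psum C)).
Local Notation hspan := (hspan (psum C)).

Lemma tens_lincomb c n (d : 'I_n -> C) (P : 'I_n -> A) :
  tens c (\sum_(i < n) d i *: P i) = \sum_(i < n) d i *: tens c (P i).
Proof. exact: (linear_lincomb (f := tens c) d P (tens_linear c)). Qed.

Lemma twist_of_lincomb N n (d : 'I_n -> C) (P : 'I_n -> A) (T : 'I_n -> int -> A) :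
  (forall i, twist_of (P i) (T i) N) ->
  twist_of (\sum_(i < n) d i *: P i) (fun l => \sum_(i < n) d i *: T i l) N.
Proof.
move=> tw; split=> [c l|l lN]; last first.
  by apply: big1 => i _; rewrite (proj2 (tw i) l lN) scaler0.
apply: etrans (congr1 (Eplus (- 1) (- l)) (tens_lincomb c d P)) _.
apply: etrans (linear_lincomb d (fun i => tens c (P i)) (@Eplus_linear R (- l))) _.
apply: etrans _ (esym (tens_lincomb c d (T^~ l))).
by apply: eq_bigr => i _; rewrite (proj1 (tw i) c l).
Qed.

Lemma twist_of_hprod s : twist_of (hprod s) (htwist s) (2 * size s).
Proof.
split=> [c l|l /orP[l0|l0]]; first exact: Eplus_tens.
  exact: htwist_lt0.
exact: htwist_gt.
Qed.

Lemma hspan_twist r P : hspan r P ->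
  exists T, twist_of P T (2 * r) /\ forall l, hspan r (T l).
Proof.
move=> [n [c [f [fP ->]]]].
have {}fP i : {s | size s = r & hprod s = f i} by apply/cid2; have [s] := fP i; exists s.
pose T (i : 'I_n) := htwist (s2val (fP i)).
exists (fun l => \sum_i c i *: T i l); split.
  apply: twist_of_lincomb => i; rewrite /T; case: (fP i) => s /= <- <-.
  exact: twist_of_hprod.
move=> l; apply: lspan_sum => i _; apply: lspanZ.
by rewrite /T; case: (fP i) => s /= <- _; apply: htwist_hspan.
Qed.

(** On M_r the common bound 2 r for the twists places all terms of the combination in one window,
    where linearity is plain algebra. *)
Lemma x_alpha_lincomb r m c n (d : 'I_n -> C) (P : 'I_n -> A) :
  (forall i, hspan r (P i)) ->
  x_alpha m (tens c (\sum_(i < n) d i *: P i)) =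
  \sum_(i < n) d i *: x_alpha m (tens c (P i)).
Proof.
move=> hP.
have tw i : {T | twist_of (P i) T (2 * r)}.
  by apply/cid; have [T [hT _]] := hspan_twist (hP i); exists T.
have twE := twist_of_lincomb d (fun i => svalP (tw i)).
apply: etrans (x_alphaE m c twE) _.
apply: etrans (congr1 (tens (1 + c)) (exchange_lincomb _ d (fun i l => sval (tw i) l%:Z))) _.
apply: etrans (tens_lincomb _ _ _) _; apply: eq_bigr => i _; congr (_ *: _).
exact: esym (x_alphaE m c (svalP (tw i))).
Qed.

Lemma x_alpha_hspan r m P : hspan r P ->
  exists2 Q, hspan r.+1 Q & x_alpha m (tens r%:Z P) = tens r.+1%:Z Q.
Proof.
move=> hP; have [T [tw hT]] := hspan_twist hP.
exists (\sum_(l < (2 * r).+1) hsym (- m - 1 - Qform 1 r%:Z + l%:Z) * T l).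
  by apply: lspan_sum => l _; apply: hspan_hsymM.
exact: (x_alphaE m r%:Z tw).
Qed.

Definition wvec (ms : seq int) : VQ := foldr (@x_alpha R) (vac R) ms.

Lemma vacE : vac R = tens 0 1.
Proof. exact: esym (tensU R 0 mone). Qed.

Lemma wvec_hspan ms :
  exists2 P, hspan (size ms) P & wvec ms = tens (size ms)%:Z P.
Proof.
elim: ms => [|m ms [P hP IH]].
  by exists 1; [rewrite -(hprod_nil (psum C)); apply: hspan_hprod|apply: vacE].
have [Q hQ QE] := x_alpha_hspan m hP.
exists Q; first exact: hQ.
exact: etrans (congr1 (@x_alpha R m) IH) QE.
Qed.

Definition wspan (r : nat) : set VQ := lspan [set wvec ms | ms in [set ms | size ms = r]].

Lemma x_alpha_wspan r m P : hspan r P -> wspan r (tens r%:Z P) ->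
  wspan r.+1 (x_alpha m (tens r%:Z P)).
Proof.
move=> hP [n [d [f [fw PE]]]].
have {fw} [ms msr msE] : exists2 ms : 'I_n -> seq int,
    forall i, size (ms i) = r & forall i, f i = wvec (ms i).
  have fw' i : {s | size s = r & wvec s = f i} by apply/cid2; have [s] := fw i; exists s.
  exists (fun i => s2val (fw' i)) => i; first exact: s2valP (fw' i).
  exact: esym (s2valP' (fw' i)).
(* The spanning vectors are put in the form M_r (x) e^(r alpha), where [x_alpha m] is known to
   respect linear combinations. *)
have [Q hQ fE] : exists2 Q : 'I_n -> A,
    forall i, hspan r (Q i) & forall i, f i = tens r%:Z (Q i).
  have fP i : {Q | hspan r Q & f i = tens r%:Z Q}.
    by apply/cid2; rewrite msE -(msr i); apply: wvec_hspan.
  exists (fun i => s2val (fP i)) => i; first exact: s2valP (fP i).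
  exact: s2valP' (fP i).
have -> : tens r%:Z P = tens r%:Z (\sum_(i < n) d i *: Q i).
  rewrite PE; apply: etrans _ (esym (tens_lincomb _ _ _)).
  by apply: eq_bigr => i _; rewrite fE.
apply: (eq_ind_r (wspan r.+1) _ (x_alpha_lincomb m r%:Z d hQ)).
apply: lspan_sum => i _; apply/lspanZ/lspan_sub.
exists (m :: ms i); first by rewrite /= msr.
by rewrite -(fE i) (msE i).
Qed.

(* h_M h_s is the l = 0 term of the expansion of x_alpha(m) h_s; in the terms
   l > 0 the sum of s drops, and h_s = 0 once that sum is negative. *)
Lemma wspan_hprod_cons r : (forall P, hspan r P -> wspan r (tens r%:Z P)) ->
  forall k s, size s = r -> wspan r.+1 (tens r.+1%:Z (hprod (k :: s))).
Proof.
move=> hr.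
(* Induction on a strict bound of the sum of [s]; [k] stays general because the correction terms
   raise it. *)
suff H (n : nat) k s : size s = r -> \sum_(j <- s) j < n%:Z ->
    wspan r.+1 (tens r.+1%:Z (hsym k * hprod s)).
  move=> k s sr; rewrite hprod_cons.
  have [n sn] : exists n : nat, \sum_(j <- s) j < n%:Z.
    by move: (\sum_(j <- s) j) => x; exists `|x|.+1; lia.
  exact: H sr sn.
elim: n k s => [|n IH] k s sr sn.
  rewrite hprod_lt0 // mulr0 tens0; exact: lspan0.
(* The mode for which the l = 0 term carries exactly h_k. *)
pose m := - k - 1 - Qform 1 r%:Z.
have kE : - m - 1 - Qform 1 r%:Z = k by rewrite /m; lia.
have hs : hspan r (hprod s) by rewrite -sr; apply: hspan_hprod.
have tw := twist_of_hprod s; rewrite sr in tw.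
pose S := \sum_(l < 2 * r) hsym (k + l.+1%:Z) * htwist s l.+1%:Z.
have xE : x_alpha m (tens r%:Z (hprod s)) =
    tens r.+1%:Z (hsym k * hprod s) + tens r.+1%:Z S.
  apply: etrans (x_alphaE m r%:Z tw) _; rewrite kE big_ord_recl htwist0 addr0.
  exact: tensD.
have -> : tens r.+1%:Z (hsym k * hprod s) =
    x_alpha m (tens r%:Z (hprod s)) - tens r.+1%:Z S by rewrite xE addrK.
apply: lspanB; first exact: (x_alpha_wspan m hs (hr _ hs)).
rewrite tens_sum; apply: lspan_sum => l _.
have [n' [d [f [fP ->]]]] := htwist_lspan (psum C) s l.+1%:Z.
have -> : hsym (k + l.+1%:Z) * (\sum_(i < n') d i *: f i) =
    \sum_(i < n') d i *: (hsym (k + l.+1%:Z) * f i).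
  exact: (linear_lincomb d f (mul_linear (hsym (k + l.+1%:Z)))).
apply: (eq_ind_r (wspan r.+1) _ (tens_lincomb _ _ _)); apply: lspan_sum => i _; apply: lspanZ.
have [s' [ss' sums'] <-] := fP i; apply: IH; first by rewrite ss'.
by rewrite sums'; move: (\sum_(j <- s) j) sn => x; lia.
Qed.

Lemma hspan_wspan r P : hspan r P -> wspan r (tens r%:Z P).
Proof.
elim: r P => [|r IH] P [n [d [f [fP ->]]]]; rewrite tens_lincomb;
  apply: lspan_sum => i _; apply: lspanZ; have [s sr <-] := fP i.
  apply: lspan_sub; exists [::]; first by [].
  by rewrite (size0nil sr) hprod_nil; apply: vacE.
case: s sr => // k s [sr]; exact: wspan_hprod_cons.
Qed.

Lemma W_wvec ms : W (wvec ms).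
Proof. by apply: lspan_sub; exists ms. Qed.

Lemma W_hprod s : W (tens (size s)%:Z (hprod s)).
Proof.
have := hspan_wspan (hspan_hprod (psum C) s).
by apply: lspan_subset => _ [ms _ <-]; apply: W_wvec.
Qed.

Lemma W_sub : @W R `<=` lspan (range (fun s => tens (size s)%:Z (hprod s))).
Proof.
apply: lspan_subset => _ [ms _ <-].
have [P [n [d [f [fP ->]]]] wE] := wvec_hspan ms.
rewrite -/(wvec ms) wE tens_lincomb; apply: lspan_sum => i _; apply/lspanZ/lspan_sub.
have [s <- <-] := fP i; exact: (ex_intro2 _ _ s I erefl).
Qed.

Lemma lfree_tens c n (P : 'I_n -> A) : lfree P -> lfree (fun i => tens c (P i)).
Proof.
move=> fP d d0; apply: fP; apply/malgP => m.
apply: etrans (esym (tens_coef c _ _)) (etrans _ (esym (mcoeff0 m))).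
by rewrite tens_lincomb d0; apply: mcoeff0.
Qed.

Lemma tens_homog c s b : b \in msupp (tens c (hprod s)) ->
  b.2 = c /\ bweight b = \sum_(k <- s) k + c ^+ 2.
Proof.
case: b => m c'; rewrite -mcoeff_neq0 => bs.
have cE : c' = c by apply: contraNeq bs => cc'; rewrite tens_coef0.
split=> //; rewrite /bweight /= cE; congr (_ + _).
have hs := homog_hprod (@homog_lspan C) (@homog1 C) (@homogM C) (@homog_psum C) s.
have mb : m \in msupp (hprod s) by move: bs; rewrite cE tens_coef mcoeff_neq0.
exact: hs mb.
Qed.

Lemma heis0_coef (v : VQ) b : (2^-1 *: heis 0 v)@_b = b.2%:~R * v@_b.
Proof.
apply: etrans (mcoeffZ _ (heis 0 v) b) _.
have e := lext_diag (fun b => (Qform 1 b.2)%:~R) v b.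
apply: etrans (congr1 (fun x => 2^-1 * x) e) _; rewrite mulrCA mulrC.
by rewrite /Qform mulr1 intrM mulKf ?pnatr_eq0.
Qed.

Lemma L0_coef (v : VQ) b : (L0 v)@_b = (bweight b)%:~R * v@_b.
Proof.
exact: etrans (lext_diag (fun b => (bweight b)%:~R) v b) (mulrC _ _).
Qed.

(** Both grading operators are diagonal in the monomial basis, so a joint eigenvector is supported
    in one bidegree; [W_intro] is the converse. *)
Lemma W_coef r s (v : VQ) b : W_ r s v -> v@_b != 0 -> b.2 = r /\ bweight b = s.
Proof.
move=> [_ hv Lv] vb; split.
  have e := etrans (esym (heis0_coef v b)) (etrans (congr1 (mcoeff b) hv) (mcoeffZ _ v b)).
  exact: intr_inj (mulIf vb e).
have e := etrans (esym (L0_coef v b)) (etrans (congr1 (mcoeff b) Lv) (mcoeffZ _ v b)).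
exact: intr_inj (mulIf vb e).
Qed.

Lemma W_intro r s (v : VQ) : W v ->
  (forall b, b \in msupp v -> b.2 = r /\ bweight b = s) -> W_ r s v.
Proof.
move=> Wv hv.
have vb (f : VQbasis -> int) t b : (b \in msupp v -> f b = t) ->
    (f b)%:~R * v@_b = t%:~R * v@_b.
  by case: (boolP (b \in msupp v)) => [_ ->|/mcoeff_outdom -> _] //; rewrite !mulr0.
split; first exact: Wv.
  apply/malgP => b; apply: etrans (heis0_coef v b) (etrans _ (esym (mcoeffZ _ v b))).
  by apply: (vb snd) => /hv[].
apply/malgP => b; apply: etrans (L0_coef v b) (etrans _ (esym (mcoeffZ _ v b))).
by apply: (vb bweight) => /hv[].
Qed.

End PrincipalSubspace.

(** * Counting multisets *)

(** [P] holds one representative of each multiset of r naturals with sum w. Integer r and w let the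
    recursion leave the nonnegative range, where the list is empty. *)
Definition enumerates (r w : int) (P : seq (seq nat)) : Prop :=
  [/\ forall s : seq nat, s \in P -> (size s)%:Z = r /\ (sumn s)%:Z = w,
      pairwise (fun s t : seq nat => ~~ perm_eq s t) P &
      forall s : seq nat, (size s)%:Z = r -> (sumn s)%:Z = w ->
        exists2 t : seq nat, t \in P & perm_eq s t].

Lemma sumn_map_succ s : sumn (map succn s) = (sumn s + size s)%N.
Proof. by elim: s => //= k s ->; lia. Qed.

(** A multiset containing 0 loses one 0; any other loses 1 in each entry, which lowers the sum by
    r. *)
Lemma enumerates_rec r w P Q : enumerates (r - 1) w P -> enumerates r (w - r) Q ->
  enumerates r w (map (cons 0%N) P ++ map (map succn) Q).
Proof.
move=> [P1 P2 P3] [Q1 Q2 Q3]; split.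
- move=> s; rewrite mem_cat => /orP[] /mapP[t tP ->] /=.
    by have [h1 h2] := P1 _ tP; split; [lia|rewrite add0n].
  by rewrite size_map sumn_map_succ; have [h1 h2] := Q1 _ tP; split; lia.
- rewrite pairwise_cat !pairwise_map; apply/and3P; split.
  + apply/allrelP => _ _ /mapP[s _ ->] /mapP[t _ ->].
    by apply/negP => /perm_mem /(_ 0%N); rewrite inE eqxx => /esym /mapP[].
  + by apply: sub_pairwise P2 => s t /=; rewrite perm_cons.
  + apply: sub_pairwise Q2 => s t /=; apply: contra.
    by apply: perm_map_inj => i j [].
- move=> s sr sw; have [s0|s0] := boolP (0%N \in s).
    have ps := perm_to_rem s0.
    have := perm_size ps; have := perm_sumn ps => /= sumE sizeE.
    have [||t tP pt] := P3 (rem 0%N s); [lia|lia|].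
    exists (0%N :: t); first by rewrite mem_cat map_f.
    by rewrite (perm_trans ps) // perm_cons.
  have sE : s = map succn (map predn s).
    rewrite -map_comp map_id_in // => k ks /=; rewrite prednK // lt0n.
    by apply: contraNneq s0 => <-.
  have [||t tQ pt] := Q3 (map predn s); rewrite ?size_map //.
    by move: sw; rewrite {1}sE sumn_map_succ size_map; lia.
  exists (map succn t); first by rewrite mem_cat map_f ?orbT.
  by rewrite sE perm_map.
Qed.

(** The recursion itself builds the list, by induction on r and, inside it, strong induction on
    w. *)
Lemma enumerates_exists (r : nat) w : exists P, enumerates r w P.
Proof.
elim: r w => [|r IH] w.
  have [->|w0] := eqVneq w 0; last first.
    exists [::]; split=> // s /eqP; rewrite eqz_nat size_eq0 => /eqP -> /esym/eqP.
    by rewrite (negbTE w0).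
  exists [:: [::]]; split=> // [s|s /eqP]; first by rewrite inE => /eqP ->.
  by rewrite eqz_nat size_eq0 => /eqP -> _; exists [::].
case: w => w; last by exists [::]; split=> // s _.
have [n] := ubnP w; elim: n w => // n IHn w wn.
have [P hP] := IH w.
have [Q hQ] : exists Q, enumerates r.+1 (w%:Z - r.+1%:Z) Q.
  have [rw|wr] := leqP r.+1 w; first by rewrite subzn //; apply: IHn; lia.
  exists [::]; split=> // s _ sw.
  by exfalso; lia.
have {}hP : enumerates (r.+1%:Z - 1) w P by have -> : r.+1%:Z - 1 = r%:Z by lia.
by eexists; apply: enumerates_rec hP hQ.
Qed.

Lemma enumerates_neg r w : r < 0 -> enumerates r w [::].
Proof. by move=> r0; split=> // s sr; move: r0; rewrite -sr. Qed.

(** * Bases of the bigraded pieces and the recursion *)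

Section GradedDimension.
Variable R : realType.
Local Notation C := R[i].
Local Notation VQ := {malg C[VQbasis]}.
Local Notation hprod := (hprod (psum C)).

Lemma hprod_perm s t : perm_eq s t -> hprod s = hprod t.
Proof. exact: perm_big. Qed.

Lemma hprod_neg s : has (fun k : int => k < 0) s -> hprod s = 0.
Proof.
elim: s => // k s IH /= /orP[k0|/IH hs]; rewrite hprod_cons.
  exact: hsym_lt0M.
by rewrite hs; apply: mulr0.
Qed.

Lemma sum_Posz s : \sum_(k <- map Posz s) k = (sumn s)%:Z.
Proof. by elim: s => [|k s IH]; rewrite ?big_nil //= big_cons IH PoszD. Qed.

Lemma W_has_dim_enumerates r s P : enumerates r (s - r ^+ 2) P ->
  has_dim (@W_ R r s) (size P).
Proof.
move=> [P1 P2 P3].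
pose t (i : 'I_(size P)) := nth [::] P i.
have tP i : t i \in P by apply: mem_nth.
have ti i : (size (t i))%:Z = r /\ (sumn (t i))%:Z = s - r ^+ 2 by apply: P1.
pose b i : VQ := tens r (hprod (map Posz (t i))).
have tsize i j : size (t i) = size (t j).
  by have [hi _] := ti i; have [hj _] := ti j; apply/eqP; rewrite -eqz_nat hi hj.
have tneq (i j : 'I_(size P)) : (i < j)%N -> ~~ perm_eq (t i) (t j).
  by move=> ij; have /(pairwiseP [::]) := P2; apply; rewrite ?inE.
have tinj i j : perm_eq (t i) (t j) -> i = j.
  move=> pij; apply: ord_inj; case: (ltngtP i j) => // /tneq /negP[] //.
  by rewrite perm_sym.
exists b; split; first by apply: lfree_tens; apply: hprod_free.
apply/seteqP; split=> v; last first.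
  move=> bv; apply: W_intro.
    apply: lspan_subset bv => _ [i _ <-]; rewrite /b.
    have [<- _] := ti i; rewrite -(size_map Posz); exact: W_hprod.
  move: bv => [n [c [f [fb ->]]]] d; rewrite -mcoeff_neq0 raddf_sum /= => dv.
  have [i fi] : exists i, (f i)@_d != 0.
    apply: contrapT => H; move: dv; rewrite big1 ?eqxx // => i _.
    rewrite (mcoeffZ (c i) (f i)); have [->|fi] := eqVneq (f i)@_d 0; first by rewrite mulr0.
    by case: H; exists i.
  have [j _ bj] := fb i; rewrite -bj mcoeff_neq0 in fi.
  have [-> ->] := tens_homog fi; split=> //.
  by rewrite sum_Posz; have [_ ->] := ti j; rewrite subrK.
move=> wv; have [Wv _ _] := wv.
have [n [c [f [fh vE]]]] := W_sub Wv.
have {fh} [u uE] : exists u : 'I_n -> seq int,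
    forall i, tens (size (u i))%:Z (hprod (u i)) = f i.
  have fu i : {u | tens (size u)%:Z (hprod u) = f i}.
    by apply/cid; have [u _ uE] := fh i; exists u.
  by exists (fun i => sval (fu i)) => i; apply: svalP (fu i).
(* Each term lives in a single bidegree, so comparing coefficients shows that the terms outside
   bidegree (r, s) may be discarded. *)
pose good i := ((size (u i))%:Z == r) && (\sum_(k <- u i) k == s - r ^+ 2).
have fcoef i d : (f i)@_d != 0 ->
    good i = (d.2 == r) && (bweight d == s).
  rewrite -uE mcoeff_neq0 => /tens_homog[-> ->]; rewrite /good.
  by case: eqP => //= ->; rewrite eq_sym subr_eq eq_sym.
have vE' : v = \sum_(i < n | good i) c i *: f i.
  apply/malgP => d.
  apply: etrans _ (esym (raddf_sum (mcoeff d) _ _ _)).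
  have fZ i : (c i *: f i)@_d = c i * (f i)@_d by apply: mcoeffZ.
  have [/andP[/eqP dr /eqP ds]|dN] := boolP ((d.2 == r) && (bweight d == s)).
    rewrite vE [RHS]big_mkcond; apply: etrans (raddf_sum (mcoeff d) _ _ _) _.
    apply: eq_bigr => i _; case: ifPn => // bad; apply: etrans (fZ i) _.
    have [->|/fcoef gi] := eqVneq (f i)@_d 0; first by rewrite mulr0.
    by rewrite gi dr ds !eqxx in bad.
  rewrite big1 => [|i gi]; last first.
    apply: etrans (fZ i) _; have [->|/fcoef gi'] := eqVneq (f i)@_d 0; first by rewrite mulr0.
    by rewrite -gi' gi in dN.
  by apply: contraNeq dN => /(W_coef wv)[-> ->]; rewrite !eqxx.
rewrite vE'; apply: lspan_sum => i /andP[/eqP ur /eqP us]; apply: lspanZ; rewrite -uE.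
(* The entries of [u i] are integers: a negative one makes the vector 0, and otherwise [u i] is a
   permutation of a member of [P]. *)
have [uneg|upos] := boolP (has (fun k : int => k < 0) (u i)).
  apply: (eq_ind_r (lspan _) (lspan0 _)).
  exact: etrans (congr1 (tens _) (hprod_neg uneg)) (tens0 _ _).
have {upos} [t0 utE] : exists t0, u i = map Posz t0.
  exists (map absz (u i)); rewrite -map_comp map_id_in // => k ku /=.
  by apply: gez0_abs; rewrite leNgt; apply: contra upos => k0; apply/hasP; exists k.
rewrite utE in ur us *; rewrite sum_Posz in us; rewrite size_map in ur.
have [t1 t1P p01] := P3 t0 ur us.
apply: lspan_sub; have t1i : (index t1 P < size P)%N by rewrite index_mem.
exists (Ordinal t1i); first by [].
have tE : t (Ordinal t1i) = t1 by apply: nth_index.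
rewrite /b tE size_map ur; congr (tens r _).
by apply: hprod_perm; rewrite perm_sym; apply: perm_map.
Qed.

Lemma chi0E r s P : enumerates r (s - r ^+ 2) P -> chi0 R r s = size P.
Proof. by move=> /W_has_dim_enumerates/ldimE. Qed.

Lemma chi0_rec r s :
  chi0 R r s = (chi0 R r (s - r)%R + chi0 R (r - 1)%R (s - 1 - 2 * (r - 1))%R)%N.
Proof.
have ex r' w : exists P, enumerates r' w P.
  case: r' => r'; first exact: enumerates_exists.
  by exists [::]; apply: enumerates_neg.
have [P hP] := ex (r - 1) (s - r ^+ 2).
have [Q hQ] := ex r (s - r ^+ 2 - r).
rewrite (chi0E (enumerates_rec hP hQ)) size_cat !size_map addnC.
congr (_ + _)%N; apply/esym/chi0E.
  by rewrite addrAC.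
(* Since (r - 1)^2 + 2 (r - 1) + 1 = r^2, removing a zero entry leaves the sum s - r^2 unchanged. *)
suff -> : s - 1 - 2 * (r - 1) - (r - 1) ^+ 2 = s - r ^+ 2 by [].
by ring.
Qed.

End GradedDimension.

Theorem corollary4p1 (R : realType) :
  chi0 R = series_add (subst_xq 1 (chi0 R))
                      (mul_monomial 1 1 (subst_xq 2 (chi0 R))).
Proof.
apply/funext => r; apply/funext => s.
by rewrite /series_add /mul_monomial /subst_xq mul1r; apply: chi0_rec.
Qed.
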